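(* Among all 2-attractors in $\mathbb{R}^d$, there exist, up to affine similarity, precisely two types whose convex hulls are polytopes: a parallelepiped (whose convex hull has $2^d$ vertices) and, when $d$ is even, a direct product of $\frac d2$ dragons (whose convex hull has $2^{3d/2}$ vertices). Every 2-attractor in $\mathbb{R}^d$ different from a parallelepiped and from a direct product of dragons has a convex hull that is an infinite zonotope with infinitely many extreme points.
   Context: An integer $d\times d$ matrix $M$ is called expanding if all its (complex) eigenvalues have modulus strictly greater than $1$. Let $M$ be an integer expanding $d\times d$ matrix with $|\det M|=2$ and let $D=\{\boldsymbol d_0,\boldsymbol d_1\}\subset\mathbb{Z}^d$ with $\boldsymbol d_1-\boldsymbol d_0\notin M\mathbb{Z}^d$. The 2-attractor generated by $M$ and $D$ is the compact set $G(M,D)=\{\sum_{j=1}^{\infty}M^{-j}\boldsymbol a_j : \boldsymbol a_j\in D \text{ for all } j\}\subset\mathbb{R}^d$. Two subsets of $\mathbb{R}^d$ are affinely similar if one is the image of the other under an invertible affine map of $\mathbb{R}^d$. A parallelepiped is a set affinely similar to $[0,1]^d$. A dragon is a subset of $\mathbb{R}^2$ affinely similar to a 2-attractor $G(M,D)\subset\mathbb{R}^2$ where $M$ has characteristic polynomial $z^2-2z+2$ or $z^2+2z+2$ (it is unique up to affine similarity). A direct product of $k$ dragons is a set affinely similar to $K_1\times\cdots\times K_k\subset(\mathbb{R}^2)^k=\mathbb{R}^{2k}$ where each $K_i$ is a dragon. An infinite zonotope in $\mathbb{R}^d$ is a Minkowski sum of a countable set of segments whose sum of lengths is finite. *)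

(* Defs.v *)
From HB Require Import structures.
From mathcomp Require Export all_boot all_order all_algebra.
From mathcomp Require Export complex.
From mathcomp Require Export all_classical all_reals all_analysis.

Set Implicit Arguments.
Unset Strict Implicit.
Unset Printing Implicit Defensive.

Export Order.TTheory GRing.Theory Num.Theory.
Export numFieldNormedType.Exports.

#[export] Set Implicit Arguments.
#[export] Unset Strict Implicit.
#[export] Unset Printing Implicit Defensive.

Local Open Scope classical_set_scope.
Local Open Scope ring_scope.

Definition expanding (R : realType) (d : nat) (M : 'M[int]_d) : Prop :=
  forall z : R[i], eigenvalue (map_mx intr M) z -> 1 < `|z|.

Definition generates_two_attractor (R : realType) (d : nat)
    (M : 'M[int]_d) (d0 d1 : 'cV[int]_d) : Prop :=
  [/\ expanding R M, `|\det M| = 2 &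
      ~ exists z : 'cV[int]_d, d1 - d0 = M *m z].

(* Indices are shifted by one: a j is the digit a_{j+1}. *)
Definition attractor (R : realType) (d : nat)
    (M : 'M[int]_d) (D : set 'cV[int]_d) : set 'cV[R]_d :=
  [set x | exists a : nat -> 'cV[int]_d,
     (forall j, D (a j)) /\
     series (fun j => invmx (map_mx intr M : 'M[R]_d) ^+ j.+1
                        *m map_mx intr (a j)) @ \oo --> x].
Arguments attractor R {d} M D.

Definition is_two_attractor (R : realType) (d : nat) (G : set 'cV[R]_d) : Prop :=
  exists (M : 'M[int]_d) (d0 d1 : 'cV[int]_d),
    generates_two_attractor R M d0 d1 /\ G = attractor R M [set d0; d1].

Definition affinely_similar (R : realType) (d : nat) (A B : set 'cV[R]_d) : Prop :=
  exists (L : 'M[R]_d) (c : 'cV[R]_d),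
    L \in unitmx /\ B = [set L *m x + c | x in A].

Definition is_parallelepiped (R : realType) (d : nat) (P : set 'cV[R]_d) : Prop :=
  affinely_similar [set x : 'cV[R]_d | forall i, 0 <= x i 0 <= 1] P.

Definition is_dragon (R : realType) (K : set 'cV[R]_2) : Prop :=
  exists (M : 'M[int]_2) (d0 d1 : 'cV[int]_2),
    [/\ generates_two_attractor R M d0 d1,
        char_poly M = 'X^2 - 2%:P * 'X + 2%:P \/
        char_poly M = 'X^2 + 2%:P * 'X + 2%:P &
        affinely_similar (attractor R M [set d0; d1]) K].

(* The coordinates of R^(k * 2) = (R^2)^k are indexed by mxvec_index i j,
   the j-th coordinate of the i-th factor. *)
Definition planar_product (R : realType) (k : nat)
    (K : 'I_k -> set 'cV[R]_2) : set 'cV[R]_(k * 2) :=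
  [set x | forall i : 'I_k, K i (\col_(j < 2) x (mxvec_index i j) 0)].

Definition is_dragon_product (R : realType) (k d : nat) (S : set 'cV[R]_d) : Prop :=
  exists (e : (k * 2)%N = d) (K : 'I_k -> set 'cV[R]_2),
    (forall i, is_dragon (K i)) /\
    affinely_similar [set castmx (e, erefl) x | x in planar_product K] S.

Definition convex_hull (R : realType) (d : nat) (A : set 'cV[R]_d) : set 'cV[R]_d :=
  smallest (@convex_set R 'cV[R]_d) A.

Definition is_polytope (R : realType) (d : nat) (P : set 'cV[R]_d) : Prop :=
  exists s : seq 'cV[R]_d, P = convex_hull [set` s].

Definition extreme_points (R : realType) (d : nat) (A : set 'cV[R]_d) :
    set 'cV[R]_d :=
  [set x | A x /\ forall (y z : 'cV[R]_d) (t : R), A y -> A z -> 0 < t < 1 ->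
     x = (1 - t) *: y + t *: z -> y = x /\ z = x].

Definition segment (R : realType) (d : nat) (a b : 'cV[R]_d) : set 'cV[R]_d :=
  [set (1 - t) *: a + t *: b | t in `[0, 1]].

(* Not the library norm on matrices, which is the maximum norm. *)
Definition euclidean_norm (R : realType) (d : nat) (x : 'cV[R]_d) : R :=
  Num.sqrt (\sum_i x i 0 ^+ 2).

(* The segments are nondegenerate and there are infinitely many of them. *)
Definition is_infinite_zonotope (R : realType) (d : nat) (Z : set 'cV[R]_d) : Prop :=
  exists a b : nat -> 'cV[R]_d,
    [/\ forall n, a n != b n,
        cvgn (series (fun n => euclidean_norm (b n - a n))) &
        Z = [set x | exists s : nat -> 'cV[R]_d,
               (forall n, segment (a n) (b n) (s n)) /\
               series s @ \oo --> x]].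

(* Main.v *)
Require Import Defs.
From mathcomp Require Import ring lra zify.
Local Open Scope classical_set_scope.
Local Open Scope ring_scope.

(* Up to translation the attractor is [{sum_j e_j w_j | e_j = 0, 1}] with
   [w_j = M^-(j+1) (d1 - d0)], and its convex hull is the zonoid
   [{sum_j t_j w_j | 0 <= t_j <= 1}].  The characteristic polynomial of [M] is
   irreducible, so [d1 - d0] is a cyclic vector, and two generators are parallel
   iff some power [M^n], [n > 0], is scalar.

   If no power is scalar, every [w_j] spans an edge of the hull; the two ends of
   an edge are extreme, and infinitely many directions need infinitely many ends.

   If [M^n] is scalar, all eigenvalues have the same modulus [r], [r^d = 2], and
   [z -> r^2 / z] is conjugation, which permutes them.  Comparing coefficients,
   [X^m] can occur only if [d] divides [2m], and what is left is [X^d +- 2] or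
   [X^d +- 2 X^(d/2) + 2].  In the first case the generators with the same index
   mod [d] are parallel and sum to binary expansions, which gives a
   parallelepiped; in the second one those with the same index mod [d/2] span a
   plane and sum to a dragon, whose hull is an octagon. *)

(** * Convex hulls and separation *)

(** [convex_hull] is the smallest convex set, with no closure taken, so its equality with the zonoid
    cannot be left to a limit argument. A non-strict separation is used instead, and what happens on
    the supporting hyperplane is settled in one dimension less. The divisibility of [2m] by [d]
    comes from powers of 2: since [r^d = 2], the coefficient identities given by [z -> r^2 / z]
    become identities between integers once norms are raised to the power [d]. Signs in the
    recurrences of the generators are immaterial, because reversing a generator only translates the
    set of sums. This is why each type is a single affine class, and why one explicit planar
    sequence can serve as the model of every dragon. For that model four steps multiply a generator
    by [- 1 / 4], so up to sign only four directions occur; this is where the octagon comes from. *)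

Lemma convex_setP (R : realType) (d : nat) (A : set 'cV[R]_d) :
  @convex_set R 'cV[R]_d A <->
  forall x y (t : R), A x -> A y -> 0 <= t <= 1 -> A ((1 - t) *: x + t *: y).
Proof.
split=> [cA x y t Ax Ay /andP[t0 t1]|cA x y l].
  have := cA y x (Itv01 t0 t1); rewrite !inE => /(_ Ay Ax).
  by rewrite addrC.
rewrite !inE => Ax Ay; have := cA y x l%:num Ay Ax; rewrite addrC; apply.
by rewrite ge0 le1.
Qed.

Lemma convex_convex_hull (R : realType) (d : nat) (A : set 'cV[R]_d) x y (t : R) :
  convex_hull A x -> convex_hull A y -> 0 <= t <= 1 ->
  convex_hull A ((1 - t) *: x + t *: y).
Proof.
move=> Ax Ay t01 C [cC AC]; move/convex_setP: (cC); apply=> //.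
  exact: Ax.
exact: Ay.
Qed.

Lemma sub_convex_hull (R : realType) (d : nat) (A : set 'cV[R]_d) :
  A `<=` convex_hull A.
Proof. exact: sub_gen_smallest. Qed.

Lemma convex_hull_sub (R : realType) (d : nat) (A C : set 'cV[R]_d) :
  (forall x y (t : R), C x -> C y -> 0 <= t <= 1 -> C ((1 - t) *: x + t *: y)) ->
  A `<=` C -> convex_hull A `<=` C.
Proof. by move=> /convex_setP cC AC; exact: smallest_sub. Qed.

Lemma mulmx_lin (R : comNzRingType) (d : nat) (f : 'rV[R]_d) (a b : R) (x y : 'cV[R]_d) :
  (f *m (a *: x + b *: y)) 0 0 = a * (f *m x) 0 0 + b * (f *m y) 0 0.
Proof. by rewrite mulmxDr -!scalemxAr mxE mxE [X in _ + X]mxE. Qed.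

(* Induction on the dimension: a functional that works on the hyperplane [s = 0]
   extends, because mixing a point above with a point below lands in it, so that
   the slopes required above do not exceed the slopes allowed below. *)
Lemma separation0 (R : realType) (d : nat) (C : set 'cV[R]_d) :
  (forall x y (t : R), C x -> C y -> 0 <= t <= 1 -> C ((1 - t) *: x + t *: y)) ->
  ~ C 0 ->
  C = set0 \/ exists2 f : 'rV[R]_d, f != 0 & forall c, C c -> 0 <= (f *m c) 0 0.
Proof.
elim: d C => [|d IH] C cC C0.
  left; apply/seteqP; split=> // x Cx; apply: C0.
  by rewrite (_ : 0 = x) //; apply/colP; case.
case: (pselect (C = set0)) => [|_]; [by left|right].
pose s (c : 'cV[R]_(1 + d)) := c 0 0.
pose h (c : 'cV[R]_(1 + d)) : 'cV[R]_d := dsubmx c.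
pose emb (h : 'cV[R]_d) : 'cV[R]_(1 + d) := col_mx 0 h.
pose H : set 'cV[R]_d := [set x | C (emb x)].
have emb0 : emb 0 = 0 by rewrite /emb col_mx0.
have cH x y (t : R) : H x -> H y -> 0 <= t <= 1 -> H ((1 - t) *: x + t *: y).
  move=> Hx Hy t01; rewrite /H /=.
  rewrite (_ : emb _ = (1 - t) *: emb x + t *: emb y); first exact: cC.
  by rewrite /emb !scale_col_mx add_col_mx !scaler0 addr0.
have H0 : ~ H 0 by rewrite /H /= emb0.
have embh c : s c = 0 -> emb (h c) = c.
  move=> sc; rewrite -[RHS]vsubmxK /emb; congr col_mx.
  apply/colP => i; rewrite ord1 !mxE -sc /s; congr (c _ _); exact: val_inj.
have fE (nu : R) (g : 'rV[R]_d) c :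
    ((row_mx nu%:M g : 'rV[R]_(1 + d)) *m c) 0 0 = nu * s c + (g *m h c) 0 0.
  rewrite -{1}(vsubmxK (c : 'cV[R]_(1 + d))) (mul_row_col nu%:M g) mxE.
  rewrite mul_scalar_mx !mxE; congr (_ * _ + _).
  by rewrite /s; congr (c _ _); exact: val_inj.
have mix p q : C p -> C q -> 0 < s p -> s q < 0 ->
    H (((- s q) / (s p - s q)) *: h p + ((s p) / (s p - s q)) *: h q).
  move=> Cp Cq sp sq.
  have spq : 0 < s p - s q by lra.
  have spq0 := lt0r_neq0 spq.
  have t01 : 0 <= s p / (s p - s q) <= 1.
    by rewrite divr_ge0 ?ler_pdivrMr ?mul1r //=; lra.
  have := cC p q _ Cp Cq t01; set c := (X in C X) => Cc.
  have sc : s c = 0.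
    by rewrite /c /s !mxE -/(s p) -/(s q); field.
  rewrite /H /=; rewrite (_ : _ + _ = h c) ?embh //.
  by apply/colP => i; rewrite /c /h !mxE; field.
have e0 : (row_mx 1%:M 0 : 'rV[R]_(1 + d)) != 0.
  by apply/eqP => /rowP /(_ (lshift d 0)); rewrite row_mxEl !mxE => /eqP; rewrite oner_eq0.
case: (pselect (exists2 p, C p & 0 < s p)) => [[p Cp sp]|Np]; last first.
  exists (row_mx (-1)%:M 0) => [|c Cc].
    rewrite -(opprK (row_mx _ _)) oppr_eq0 opp_row_mx oppr0.
    by rewrite -raddfN opprK.
  rewrite fE mul0mx mxE addr0 mulN1r oppr_ge0 leNgt; apply/negP => sc.
  by apply: Np; exists c.
case: (pselect (exists2 q, C q & s q < 0)) => [[q Cq sq]|Nq]; last first.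
  exists (row_mx 1%:M 0) => // c Cc.
  rewrite fE mul0mx mxE addr0 mul1r leNgt; apply/negP => sc.
  by apply: Nq; exists c.
case: (IH H cH H0) => [Hs0|[g g0 gH]].
  by have := mix p q Cp Cq sp sq; rewrite Hs0.
pose G (c : 'cV[R]_(1 + d)) := (g *m h c) 0 0.
have Gle p' q' : C p' -> C q' -> 0 < s p' -> s q' < 0 ->
    - G p' / s p' <= - G q' / s q'.
  move=> Cp' Cq' sp' sq'.
  have := gH _ (mix p' q' Cp' Cq' sp' sq').
  rewrite mulmx_lin -/(G p') -/(G q') => le0.
  have lt1 : 0 < s p' - s q' by lra.
  have lt10 := lt0r_neq0 lt1.
  have {le0} : 0 <= - s q' * G p' + s p' * G q'.
    have := mulr_ge0 (ltW lt1) le0; congr (_ <= _); field.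
    exact: lt10.
  move=> le0; rewrite -subr_ge0.
  rewrite (_ : _ - _ = (- s q' * G p' + s p' * G q') / (s p' * - s q')); last first.
    by field; rewrite (ltr0_neq0 sq') (lt0r_neq0 sp').
  by rewrite divr_ge0 // mulr_ge0 ?oppr_ge0 // ltW.
(* The coefficient of [s] must be at least every slope in [S] and at most every slope from the
   points with [s c < 0]; the supremum of [S] is both. *)
pose S := [set - G c / s c | c in [set c | C c /\ 0 < s c]].
have Sp : S (- G p / s p) by exists p.
have Sub q' : C q' -> s q' < 0 -> ubound S (- G q' / s q').
  by move=> Cq' sq' _ [c [Cc sc] <-]; exact: Gle.
exists (row_mx (sup S)%:M g) => [|c Cc].
  apply: contra g0 => /eqP /(congr1 (fun u => rsubmx (u : 'rV[R]_(1 + d)))).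
  by rewrite row_mxKr linear0 => ->.
rewrite fE -/(G c).
case: (ltrgt0P (s c)) => sc.
- have le1 : - G c / s c <= sup S.
    apply: ub_le_sup; last by exists c.
    by exists (- G q / s q); exact: Sub.
  by move: le1; rewrite ler_pdivrMr // -subr_ge0 opprK.
- have le1 : sup S <= - G c / s c.
    by apply: ge_sup; [exists (- G p / s p)|exact: Sub].
  by move: le1; rewrite ler_ndivlMr // -subr_ge0 opprK.
- rewrite sc mulr0 add0r; apply: gH; by rewrite /H /= embh.
Qed.

(** The set [x - C] reduces this to separation from 0. The inequality is not strict, as [C] need not
    be closed. *)
Lemma separation (R : realType) (d : nat) (C : set 'cV[R]_d) (x : 'cV[R]_d) :
  (forall x y (t : R), C x -> C y -> 0 <= t <= 1 -> C ((1 - t) *: x + t *: y)) ->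
  C !=set0 -> ~ C x ->
  exists2 f : 'rV[R]_d, f != 0 & forall c, C c -> (f *m c) 0 0 <= (f *m x) 0 0.
Proof.
move=> cC [c0 Cc0] Cx.
have [| |C0|[f f0 fC]] := @separation0 R d [set y | C (x - y)].
- move=> y z t /= Cy Cz t01.
  rewrite (_ : _ - _ = (1 - t) *: (x - y) + t *: (x - z)); first exact: cC.
  by apply/colP => i; rewrite !mxE; ring.
- by rewrite /= subr0.
- have : [set y | C (x - y)] (x - c0) by rewrite /= subKr.
  by rewrite C0.
exists f => // c Cc; have := fC (x - c); rewrite /= subKr => /(_ Cc).
by rewrite mulmxBr !mxE subr_ge0.
Qed.

(** * Vector series *)

Lemma cvg_sumr (R : realType) (I : finType) (f : I -> nat -> R) (l : I -> R) :
  (forall k, f k @ \oo --> l k) -> (fun n => \sum_k f k n) @ \oo --> \sum_k l k.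
Proof.
move=> h; elim: (index_enum I) => [|k r IH].
  by under eq_fun => n do rewrite big_nil; rewrite big_nil; exact: cvg_cst.
by under eq_fun => n do rewrite big_cons; rewrite big_cons; apply: cvgD.
Qed.

Lemma cvg_colP (R : realType) (d : nat) (u : nat -> 'cV[R]_d) (s : 'cV[R]_d) :
  (u @ \oo --> s) <-> forall i, (fun n => u n i 0) @ \oo --> s i 0.
Proof.
split=> [us i|us].
  exact: (cvg_comp _ _ us (@coord_continuous R d 1 i 0 s)).
apply/cvg_mx_entourageP => A entA.
have : \forall n \near \oo, forall i : 'I_d, (s i 0, u n i 0) \in A.
  apply: filter_forall => i; have /cvg_entourageP /(_ A entA) := us i.
  by rewrite near_map => H; near=> n; rewrite inE; near: n.
by rewrite near_map => H; near=> n => i j; rewrite ord1; move: i; near: n.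
Unshelve. all: by end_near. Qed.

(** Absolute convergence in each coordinate, so that every bounded choice of coefficients gives a
    convergent series. *)
Definition summable (R : realType) (d : nat) (w : nat -> 'cV[R]_d) : Prop :=
  forall i, cvgn (series (fun j => `|w j i 0|)).

Definition has_sum (R : realType) (d : nat) (w : nat -> 'cV[R]_d) (s : 'cV[R]_d) : Prop :=
  series w @ \oo --> s.

Lemma has_sumP (R : realType) (d : nat) (w : nat -> 'cV[R]_d) s :
  has_sum w s <-> forall i, series (fun j => w j i 0) @ \oo --> s i 0.
Proof.
rewrite /has_sum cvg_colP.
have E i : (fun n => series w n i 0) = series (fun j => w j i 0).
  by apply/funext => n; rewrite /series /= summxE.
by split=> ws i; have := ws i; rewrite E.
Qed.

Lemma has_sum_unique (R : realType) (d : nat) (w : nat -> 'cV[R]_d) s s' :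
  has_sum w s -> has_sum w s' -> s = s'.
Proof.
move=> /has_sumP h /has_sumP h'; apply/colP => i.
exact: (cvg_unique _ (h i) (h' i)).
Qed.

Lemma has_sum_mul (R : realType) (d e : nat) (A : 'M[R]_(e, d)) (w : nat -> 'cV[R]_d) s :
  has_sum w s -> has_sum (fun j => A *m w j) (A *m s).
Proof.
rewrite /has_sum !cvg_colP => h i.
under eq_fun => n do rewrite /series /= -mulmx_sumr mxE.
rewrite mxE; apply: cvg_sumr => k; apply: cvgMl_tmp.
exact: h.
Qed.

Lemma has_sumD (R : realType) (d : nat) (w w' : nat -> 'cV[R]_d) s s' :
  has_sum w s -> has_sum w' s' -> has_sum (fun j => w j + w' j) (s + s').
Proof.
rewrite /has_sum => h h'; rewrite (_ : series _ = series w \+ series w').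
  exact: cvgD.
by apply/funext => n; rewrite /series /= big_split.
Qed.

Lemma has_sumZ (R : realType) (d : nat) (a : R) (w : nat -> 'cV[R]_d) s :
  has_sum w s -> has_sum (fun j => a *: w j) (a *: s).
Proof.
move=> h; have := has_sum_mul (A := a%:M) h; rewrite mul_scalar_mx.
by under eq_fun => j do rewrite mul_scalar_mx.
Qed.

Lemma has_sumB (R : realType) (d : nat) (w w' : nat -> 'cV[R]_d) s s' :
  has_sum w s -> has_sum w' s' -> has_sum (fun j => w j - w' j) (s - s').
Proof.
move=> h /(has_sumZ (a := -1)) h'; rewrite -scaleN1r.
rewrite (_ : (fun j => _) = (fun j => w j + -1 *: w' j)); first exact: has_sumD.
by apply/funext => j; rewrite scaleN1r.
Qed.

Lemma has_sum_finite (R : realType) (d n : nat) (w : nat -> 'cV[R]_d) :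
  (forall j, (n <= j)%N -> w j = 0) -> has_sum w (\sum_(j < n) w j).
Proof.
move=> w0; apply: (@cvg_near_cst _ _ _ _ eventually).
exists n => // m /= nm; rewrite /series /= -(big_mkord xpredT w).
rewrite (big_cat_nat (leq0n n) nm) /= [X in _ + X]big1_seq ?addr0 // => i.
by rewrite mem_index_iota => /andP[_ /andP[/w0]].
Qed.

Lemma has_sum0 (R : realType) (d : nat) : has_sum (fun=> 0 : 'cV[R]_d) 0.
Proof. by have := @has_sum_finite R d 0 (fun=> 0); rewrite big_ord0; apply. Qed.

Lemma summableMl (R : realType) (d : nat) (t : nat -> R) (B : R) (w : nat -> 'cV[R]_d) :
  (forall j, `|t j| <= B) -> summable w -> summable (fun j => t j *: w j).
Proof.
move=> tB sw i.
have cB : cvgn (series (B *: (fun j => `|w j i 0|))) by apply: is_cvg_seriesZ.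
apply: series_le_cvg cB => j //; first by rewrite mulr_ge0 // (le_trans _ (tB j)).
by rewrite mxE normrM ler_wpM2r.
Qed.

Lemma summable_has_sum (R : realType) (d : nat) (w : nat -> 'cV[R]_d) :
  summable w -> exists s, has_sum w s.
Proof.
move=> sw; exists (\col_i limn (series (fun j => w j i 0))).
apply/has_sumP => i; rewrite mxE; apply: normed_cvg; exact: sw.
Qed.

Lemma summable_mul (R : realType) (d e : nat) (A : 'M[R]_(e, d)) (w : nat -> 'cV[R]_d) :
  summable w -> summable (fun j => A *m w j).
Proof.
move=> sw i.
have c1 : cvgn (series (fun j => \sum_k `|A i k| * `|w j k 0|)).
  rewrite (_ : series _ = fun n => \sum_k `|A i k| * series (fun j => `|w j k 0|) n).
    apply/cvg_ex; exists (\sum_k `|A i k| * limn (series (fun j => `|w j k 0|))).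
    by apply: cvg_sumr => k; apply: cvgMl_tmp; exact: sw.
  apply/funext => n; rewrite /series /= exchange_big /=; apply: eq_bigr => k _.
  by rewrite mulr_sumr.
apply: series_le_cvg c1 => j //; first by apply: sumr_ge0 => k _; rewrite mulr_ge0.
rewrite mxE; apply: le_trans (ler_norm_sum _ _ _) _.
by apply: ler_sum => k _; rewrite normrM.
Qed.

(** * Zonoids and their vertices *)

Definition subset_sums (R : realType) (d : nat) (w : nat -> 'cV[R]_d) : set 'cV[R]_d :=
  [set x | exists e : nat -> bool, has_sum (fun j => (e j)%:R *: w j) x].

Definition zonoid (R : realType) (d : nat) (w : nat -> 'cV[R]_d) : set 'cV[R]_d :=
  [set x | exists t : nat -> R,
     (forall j, 0 <= t j <= 1) /\ has_sum (fun j => t j *: w j) x].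

Lemma bool01 (R : realType) (b : bool) : 0 <= (b%:R : R) <= 1.
Proof. by case: b; rewrite ?lexx ler01. Qed.

Lemma summable_coef01 (R : realType) (d : nat) (t : nat -> R) (w : nat -> 'cV[R]_d) :
  (forall j, 0 <= t j <= 1) -> summable w -> exists s, has_sum (fun j => t j *: w j) s.
Proof.
move=> t01 sw; apply: summable_has_sum; apply: (summableMl (B := 1)) => // j.
by have /andP[t0 t1] := t01 j; rewrite ger0_norm.
Qed.

Lemma subset_sums_zonoid (R : realType) (d : nat) (w : nat -> 'cV[R]_d) :
  subset_sums w `<=` zonoid w.
Proof.
by move=> x [e hx]; exists (fun j => (e j)%:R); split=> // j; exact: bool01.
Qed.

Lemma zonoid_convex (R : realType) (d : nat) (w : nat -> 'cV[R]_d) x y (t : R) :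
  zonoid w x -> zonoid w y -> 0 <= t <= 1 -> zonoid w ((1 - t) *: x + t *: y).
Proof.
move=> [a [a01 hx]] [b [b01 hy]] /andP[t0 t1].
exists (fun j => (1 - t) * a j + t * b j); split=> [j|].
  have /andP[a0 a1] := a01 j; have /andP[b0 b1] := b01 j.
  by apply/andP; split; nra.
have := has_sumD (has_sumZ (a := 1 - t) hx) (has_sumZ (a := t) hy).
by congr has_sum; apply/funext => j; rewrite !scalerA -scalerDl.
Qed.

Lemma ge0_series_eq0 (R : realType) (c : nat -> R) (L : R) :
  (forall j, 0 <= c j) -> series c @ \oo --> L -> L <= 0 -> forall j, c j = 0.
Proof.
move=> c0 cL L0 j; apply/eqP; rewrite eq_le c0 andbT.
have nd : nondecreasing_seq (series c).
  by apply/nondecreasing_seqP => n; rewrite seriesSr lerDl.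
have le1 : series c j.+1 <= L.
  by rewrite -(cvg_lim _ cL) //; apply: nondecreasing_cvgn_le => //; apply/cvg_ex; exists L.
apply: le_trans L0; apply: le_trans le1; rewrite seriesSr lerDr.
exact: sumr_ge0.
Qed.

Lemma has_sum_functional (R : realType) (d : nat) (f : 'rV[R]_d) (w : nat -> 'cV[R]_d) s :
  has_sum w s -> series (fun j => (f *m w j) 0 0) @ \oo --> (f *m s) 0 0.
Proof. by move=> /(has_sum_mul (A := f)) /has_sumP /(_ 0). Qed.

(** Each [m j] is the better end of [[0, 1]] for the sign of [f] on [w j], so [s] maximizes [f]. If
    [x] also attains the maximum, a series of nonnegative terms has sum at most 0 and every term
    vanishes. Where [f] vanishes, [m] is left free. *)
Lemma max_coord (R : realType) (d : nat) (f : 'rV[R]_d) (w : nat -> 'cV[R]_d)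
    (t m : nat -> R) (x s : 'cV[R]_d) :
  (forall j, 0 <= t j <= 1) ->
  (forall j, (f *m w j) 0 0 != 0 -> m j = (0 < (f *m w j) 0 0)%R%:R) ->
  has_sum (fun j => t j *: w j) x -> has_sum (fun j => m j *: w j) s ->
  (f *m x) 0 0 <= (f *m s) 0 0 /\
  ((f *m s) 0 0 <= (f *m x) 0 0 -> forall j, (f *m w j) 0 0 != 0 -> t j = m j).
Proof.
move=> t01 mE hx hs.
pose c j := (m j - t j) * (f *m w j) 0 0.
have c0 j : 0 <= c j.
  rewrite /c; have /andP[t0 t1] := t01 j.
  case: (ltrgt0P ((f *m w j) 0 0)) (mE j) => [fp|fn|->] mj; last by rewrite mulr0.
    by rewrite mj // mulr_ge0 ?subr_ge0 // ltW.
  by rewrite mj ?sub0r ?mulNr ?oppr_ge0 ?mulr_ge0_le0 // ltW.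
have cs : series c @ \oo --> (f *m s) 0 0 - (f *m x) 0 0.
  have := has_sum_functional (f := f) (has_sumB hs hx).
  rewrite mulmxBr mxE [X in _ + X]mxE (_ : (fun j => _) = c) //.
  by apply/funext => j; rewrite -scalerBl -scalemxAr mxE.
split=> [|le1 j fj].
  rewrite -subr_ge0 -(cvg_lim _ cs) //; apply: limr_ge; first by apply/cvg_ex; eexists; exact: cs.
  by apply: nearW => n; exact: sumr_ge0.
have := ge0_series_eq0 c0 cs; rewrite subr_le0 => /(_ le1 j)/eqP.
by rewrite mulf_eq0 (negbTE fj) orbF subr_eq0 => /eqP ->.
Qed.

Lemma subset_sums0 (R : realType) (d : nat) (w : nat -> 'cV[R]_d) : subset_sums w 0.
Proof.
exists (fun=> false); have := @has_sum0 R d; congr has_sum.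
by apply/funext => j; rewrite scale0r.
Qed.

(* A point outside the hull is separated from it by a functional [f]; then its
   coefficients are forced to be 0 or 1 wherever [f] does not vanish, and the
   remaining generators lie in the hyperplane [ker f]. *)
Lemma zonoid_sub_hull (R : realType) (d : nat) (w : nat -> 'cV[R]_d) :
  summable w -> zonoid w `<=` convex_hull (subset_sums w).
Proof.
have [n] := ubnP d; elim: n d w => // n IH d w dn sw x [t [t01 hx]].
apply: contrapT => nx.
have ne0 : convex_hull (subset_sums w) !=set0.
  by exists 0; apply: sub_convex_hull; exact: subset_sums0.
have [f f0 fC] := separation (@convex_convex_hull R d (subset_sums w)) ne0 nx.
(* The rows of [K] are a basis of [ker f], and [pinvmx K] computes coordinates in it; the induction
   takes place in these coordinates. *)
set K := row_base (kermx f^T).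
have rK : (\rank (kermx f^T) < n)%N.
  have := rank_leq_col f.
  by rewrite mxrank_ker mxrank_tr rank_rV f0 /=; move: dn; lia.
have KfT (y : 'cV[R]_d) : (f *m y) 0 0 = 0 -> y^T *m pinvmx K *m K = y^T.
  move=> fy; apply: mulmxKpV; rewrite eq_row_base.
  apply/sub_kermxP; rewrite -trmx_mul; apply/matrixP => i j.
  by rewrite !ord1 mxE fy [RHS]mxE.
pose b j := (f *m w j) 0 0 == 0.
pose e0 j := 0 < (f *m w j) 0 0.
have [s hs] := summable_coef01 (fun j => bool01 R (e0 j)) sw.
have sG : subset_sums w s by exists e0.
have [_ /(_ (fC _ (sub_convex_hull sG)))] :=
  max_coord (f := f) t01 (fun j _ => erefl (e0 j)%:R) hx hs.
move=> te0.
pose u j := (pinvmx K)^T *m ((b j)%:R *: w j).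
have su : summable u.
  apply: summable_mul; apply: (summableMl (B := 1)) => // j.
  by have /andP[? ?] := bool01 R (b j); rewrite ger0_norm.
have Ku j : K^T *m u j = (b j)%:R *: w j.
  rewrite /u /b; case: eqP => fj; last by rewrite !scale0r !mulmx0.
  by apply: trmx_inj; rewrite scale1r !trmx_mul !trmxK KfT.
have [z hz] := summable_coef01 t01 su.
have xE : x = s + K^T *m z.
  apply: (has_sum_unique hx); have := has_sumD hs (has_sum_mul (A := K^T) hz).
  congr has_sum; apply/funext => j; rewrite -scalemxAr Ku /b.
  case: eqP => [fj|/eqP fj]; first by rewrite /e0 fj ltxx scale0r add0r scale1r.
  by rewrite scale0r scaler0 addr0 te0.
have zu : zonoid u z by exists t.
have := IH _ _ rK su _ zu.
suff /[apply] : convex_hull (subset_sums u) `<=`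
    [set y | convex_hull (subset_sums w) (s + K^T *m y)] by rewrite /= -xE.
apply: convex_hull_sub => [y y' r /= hy hy' r01|y [e hy]] /=.
  rewrite (_ : _ + _ = (1 - r) *: (s + K^T *m y) + r *: (s + K^T *m y')).
    exact: convex_convex_hull.
  rewrite !scalerDr mulmxDr -!scalemxAr addrACA -scalerDl subrK scale1r //.
(* Outside [ker f] the coefficient is [e0 j], inside it is [e j]; the supports are disjoint, so the
   disjunction is the sum. *)
apply: sub_convex_hull; exists (fun j => e0 j || (e j && b j)).
have := has_sumD hs (has_sum_mul (A := K^T) hy).
congr has_sum; apply/funext => j; rewrite -scalemxAr Ku /b /e0.
by case: ltrgt0P; case: (e j); rewrite /= ?scale1r ?scale0r ?scaler0 ?addr0 ?add0r.
Qed.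

Lemma convex_hull_subset_sums (R : realType) (d : nat) (w : nat -> 'cV[R]_d) :
  summable w -> convex_hull (subset_sums w) = zonoid w.
Proof.
move=> sw; apply/seteqP; split; last exact: zonoid_sub_hull.
by apply: convex_hull_sub; [exact: zonoid_convex|exact: subset_sums_zonoid].
Qed.

Lemma real_not_countable (R : realType) : ~ countable [set: R].
Proof.
move=> cR.
have c01 : countable (`[0, 1]%classic : set R).
  exact: (sub_countable (subset_card_le (@subsetT _ _)) cR).
have := countable_lebesgue_measure0 c01.
rewrite lebesgue_measure_itv /= lte_fin ltr01 -EFinB subr0 => /eqP.
by rewrite eqe oner_eq0.
Qed.

(** Along the moment curve [(1, s, s^2, ...)] each [u i] becomes a nonzero polynomial in [s]. The
    parameters to avoid are the roots of countably many polynomials, and the reals are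
    uncountable. *)
Lemma exists_functional_neq0 (R : realType) (d : nat) (u : nat -> 'cV[R]_d) :
  (forall i, u i != 0) -> exists f : 'rV[R]_d, forall i, (f *m u i) 0 0 != 0.
Proof.
move=> u0; pose p i : {poly R} := \poly_(k < d) oapp (fun k' => u i k' 0) 0 (insub k).
have p0 i : p i != 0.
  apply: contra (u0 i) => /eqP /polyP pi; apply/eqP/colP => k.
  by have := pi k; rewrite coef_poly ltn_ord valK coef0 mxE.
pose f s : 'rV[R]_d := \row_k s ^+ k.
have fE s i : (f s *m u i) 0 0 = (p i).[s].
  rewrite horner_poly mxE; apply: eq_bigr => k _.
  by rewrite mxE valK /= mulrC.
have cB : countable (\bigcup_i [set s | root (p i) s]).
  apply: bigcup_countable => // i _; apply: finite_set_countable.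
  rewrite (_ : [set s | _] = [set` polyrcf.rootsR (p i)]).
    exact: finite_seq.
  apply/seteqP; split=> s /=; rewrite -(polyrcf.roots_on_rootsR (p0 i)) in_itv //=.
have [s sB] : exists s, ~ (\bigcup_i [set s | root (p i) s]) s.
  apply: contrapT => /forallNP H; apply: (@real_not_countable R).
  rewrite (_ : setT = \bigcup_i [set s | root (p i) s]) //.
  by apply/seteqP; split=> // s _; apply: contrapT; exact: H.
exists (f s) => i; rewrite fE; apply/negP => ri.
by apply: sB; exists i.
Qed.

(** [Q] is the projection modulo the line of [w j]. It kills no other generator, since none is a
    multiple of [w j], and a functional nonzero on all the images is pulled back along it. *)
Lemma exists_functional_kernel (R : realType) (d : nat) (w : nat -> 'cV[R]_d) (j : nat) :
  (forall i (mu : R), i != j -> w i != mu *: w j) -> w j != 0 ->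
  exists f : 'rV[R]_d,
    (f *m w j) 0 0 = 0 /\ forall i, i != j -> (f *m w i) 0 0 != 0.
Proof.
move=> npar wj0; pose Q := (cokermx (w j)^T)^T.
have QE (y : 'cV[R]_d) : (Q *m y == 0) = (y^T <= (w j)^T)%MS.
  by rewrite submxE -[y in LHS]trmxK -trmx_mul trmx_eq0.
(* The entry at [j] is a placeholder: [Q *m w j] is zero, and a nonzero vector is required at every
   index. *)
pose u i := if i == j then w j else Q *m w i.
have [i|g gu] := @exists_functional_neq0 R d u.
  rewrite /u; case: (eqVneq i j) => [//|ij]; rewrite QE; apply/negP => /sub_rVP[a].
  move=> /(congr1 trmx); rewrite linearZ /= !trmxK => wij.
  by have := npar i a ij; rewrite wij eqxx.
exists (g *m Q); split=> [|i ij].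
  by have := QE (w j); rewrite submx_refl -mulmxA => /eqP ->; rewrite mulmx0 mxE.
by have := gu i; rewrite /u (negbTE ij) mulmxA.
Qed.

(** The face of the zonoid where [f] is maximal is a translate of the segment from 0 to [w j], since
    all other coefficients are forced. The coefficient of [w j] in [s] is 0 or 1, so [s] is an end
    of this edge. *)
Lemma extreme_point_functional (R : realType) (d : nat) (w : nat -> 'cV[R]_d)
    (f : 'rV[R]_d) (j : nat) (e : nat -> bool) (s : 'cV[R]_d) :
  summable w -> w j != 0 ->
  (forall i, i != j -> (f *m w i) 0 0 != 0 /\ e i = (0 < (f *m w i) 0 0)) ->
  (f *m w j) 0 0 = 0 ->
  has_sum (fun i => (e i)%:R *: w i) s ->
  extreme_points (convex_hull (subset_sums w)) s.
Proof.
move=> sw wj0 fe fj hs; split.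
  by apply: sub_convex_hull; exists e.
rewrite convex_hull_subset_sums // => y z t [a [a01 ha]] [b [b01 hb]] /andP[t0 t1] sE.
have eE i : (f *m w i) 0 0 != 0 -> (e i)%:R = (0 < (f *m w i) 0 0)%R%:R :> R.
  move=> fi; have [|_ -> //] := fe i.
  by apply: contra fi => /eqP ->; rewrite fj.
have [ys aE] := max_coord a01 eE ha hs.
have [zs bE] := max_coord b01 eE hb hs.
have fsE : (f *m s) 0 0 = (1 - t) * (f *m y) 0 0 + t * (f *m z) 0 0.
  by rewrite {1}sE mulmx_lin.
have {aE} aE : forall i, i != j -> a i = (e i)%:R.
  by move=> i ij; apply: aE; [nra|case: (fe i ij)].
have {bE} bE : forall i, i != j -> b i = (e i)%:R.
  by move=> i ij; apply: bE; [nra|case: (fe i ij)].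
have sub (c : nat -> R) v : (forall i, i != j -> c i = (e i)%:R) ->
    has_sum (fun i => c i *: w i) v -> v - s = (c j - (e j)%:R) *: w j.
  move=> cE hv; apply: (has_sum_unique (has_sumB hv hs)).
  have := @has_sum_finite R d j.+1 (fun i => (c i - (e i)%:R) *: w i).
  rewrite big_ord_recr /= big1 ?add0r => [|i _]; last first.
    by rewrite cE ?subrr ?scale0r // neq_ltn ltn_ord.
  rewrite (_ : (fun i => c i *: w i - _) = (fun i => (c i - (e i)%:R) *: w i)).
    by apply=> i ji; rewrite cE ?subrr ?scale0r // neq_ltn ji orbT.
  by apply/funext => i; rewrite scalerBl.
have ya := sub a y aE ha; have zb := sub b z bE hb.
have : ((1 - t) * (a j - (e j)%:R) + t * (b j - (e j)%:R)) *: w j = 0.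
  rewrite scalerDl -!scalerA -ya -zb !scalerBr addrACA -opprD -sE -scalerDl.
  by rewrite subrK scale1r subrr.
move/eqP; rewrite scaler_eq0 (negbTE wj0) orbF => /eqP ab0.
have /andP[a0 a1] := a01 j; have /andP[b0 b1] := b01 j.
have [aj bj] : a j = (e j)%:R /\ b j = (e j)%:R.
  by move: ab0; case: (e j) => /=; rewrite ?mulr1n ?mulr0n => ab0; split; nra.
by split; apply/eqP; rewrite -subr_eq0 ?ya ?zb ?aj ?bj subrr scale0r.
Qed.

Lemma has_sum_delta (R : realType) (d : nat) (w : nat -> 'cV[R]_d) (j : nat) :
  has_sum (fun i => (i == j)%:R *: w i) (w j).
Proof.
have := @has_sum_finite R d j.+1 (fun i => (i == j)%:R *: w i).
rewrite big_ord_recr /= big1 ?add0r ?eqxx ?scale1r => [hj|i _]; last first.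
  by rewrite ltn_eqF ?scale0r.
by apply: hj => i ji; rewrite gtn_eqF ?scale0r.
Qed.

(** Every [j] yields a pair of extreme points with difference [w j]. Distinct indices have distinct
    differences, so the indices inject into pairs of extreme points. *)
Lemma infinite_extreme_points (R : realType) (d : nat) (w : nat -> 'cV[R]_d) :
  summable w -> (forall i j (mu : R), i != j -> w i != mu *: w j) ->
  infinite_set (extreme_points (convex_hull (subset_sums w))).
Proof.
move=> sw npar; set E := extreme_points _ => finE.
have w0 i : w i != 0 by have := npar i i.+1 0; rewrite scale0r; apply; lia.
have edge j : exists y, E y /\ E (y + w j).
  have [f [fj fi]] := exists_functional_kernel (npar ^~ j) (w0 j).
  pose e i := (i != j) && (0 < (f *m w i) 0 0).
  have [y hy] := summable_coef01 (fun i => bool01 R (e i)) sw.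
  exists y; split.
    apply: (extreme_point_functional sw (w0 j) _ fj hy) => i ij.
    by split; [exact: fi|rewrite /e ij].
  apply: (extreme_point_functional (f := f) (j := j) (e := fun i => (i == j) || e i)) => //.
    by move=> i ij; split; [exact: fi|rewrite /e ij (negbTE ij)].
  have hj := has_sum_delta (w := w) (j := j).
  have := has_sumD hy hj; congr has_sum.
  apply/funext => i; rewrite -scalerDl -natrD /e.
  by case: eqP; rewrite ?addn0.
have [y yE] := choice edge.
apply: infinite_nat.
rewrite (_ : setT = (fun j => (y j, y j + w j)) @^-1` (E `*` E)).
  apply: finite_preimage; last exact: finite_setX.
  move=> i j _ _ [yij]; rewrite yij => /addrI wij.
  apply/eqP; apply: contraT => ij; have := npar i j 1 ij.
  by rewrite scale1r wij eqxx.
by apply/seteqP; split=> // j _; exact: yE.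
Qed.

(** * Irreducibility and cyclic vectors *)

Local Notation pZtoQ := (map_poly (intr : int -> rat)).

Lemma prodr_gt1 (F : numDomainType) (r : seq F) :
  r != [::] -> (forall z, z \in r -> 1 < z) -> 1 < \prod_(z <- r) z.
Proof.
have ge1 s : (forall z, z \in s -> 1 < z) -> 1 <= \prod_(z <- s) z :> F.
  move=> s1; rewrite big_seq; elim/big_rec: _ => // z x zs x1.
  by rewrite mulr_ege1 // ltW // s1.
case: r => // z r _ zr; rewrite big_cons.
have z1 : 1 < z by apply: zr; rewrite mem_head.
apply: (lt_le_trans z1); rewrite ler_peMr ?(ltW (lt_trans ltr01 z1)) //.
by apply: ge1 => y yr; apply: zr; rewrite in_cons yr orbT.
Qed.

Lemma norm_coef0_prod (F : closedFieldType) (p : {poly F}) (r : seq F) :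
  p = lead_coef p *: \prod_(z <- r) ('X - z%:P) ->
  p`_0 = lead_coef p * \prod_(z <- r) - z.
Proof.
move=> pE; rewrite {1}pE -horner_coef0 hornerZ horner_prod.
by congr (_ * _); apply: eq_bigr => z _; rewrite !hornerE.
Qed.

(** Over [R[i]] the constant term is, up to a factor of modulus 1, the product of the roots, and
    there is at least one root. *)
Lemma int_poly_coef0_gt1 (R : realType) (q : {poly int}) :
  `|lead_coef q| = 1 -> (1 < size q)%N ->
  (forall z : R[i], root (map_poly intr q) z -> 1 < `|z|) -> 1 < `|q`_0|.
Proof.
move=> lq sq q1; set P := map_poly intr q : {poly R[i]}.
have [r PE] := closed_field_poly_normal P.
have inj : injective (intr : int -> R[i]) by exact: intr_inj.
have lP : lead_coef P = (lead_coef q)%:~R by rewrite lead_coef_map_inj.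
have lP1 : `|lead_coef P| = 1 by rewrite lP -intr_norm lq.
have lP0 : lead_coef P != 0 by rewrite -normr_eq0 lP1 oner_eq0.
have := norm_coef0_prod PE => /(congr1 Num.norm).
rewrite normrM lP1 mul1r coef_map /= -intr_norm normr_prod => E.
rewrite -(ltr_int R[i]) E -(big_map (fun z => `|- z|) xpredT id); apply: prodr_gt1.
  rewrite -size_eq0 size_map; move: sq; rewrite -(size_map_inj_poly inj) // -/P PE.
  by rewrite size_scale // size_prod_XsubC; case: (size r).
move=> y /mapP[z zr ->]; rewrite normrN; apply: q1.
by rewrite -/P PE rootZ // root_prod_XsubC.
Qed.

Lemma expanding_root (R : realType) (d : nat) (M : 'M[int]_d) (z : R[i]) :
  expanding R M -> root (map_poly intr (char_poly M)) z -> 1 < `|z|.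
Proof. by move=> eM; rewrite map_char_poly => rz; apply: eM; rewrite eigenvalue_root_char. Qed.

(* A proper factor over Q comes from a factorization over Z, where one of the
   constant terms is a unit; but it is the product of roots of modulus > 1. *)
Lemma expanding_irreducible (R : realType) (d : nat) (M : 'M[int]_d) :
  (0 < d)%N -> expanding R M -> `|\det M| = 2 ->
  irreducible_poly (pZtoQ (char_poly M)).
Proof.
move=> d0 eM dM; set p := char_poly M.
split=> [|q sq]; first by rewrite size_rat_int_poly size_char_poly.
(* Gauss's lemma: a rational divisor is a scalar multiple of an integer divisor. *)
move=> /dvdpP_rat_int[p1 [a a0 qE] [r pE]].
have p_monic : lead_coef p = 1 by apply/eqP; rewrite -monicE char_poly_monic.
have : lead_coef p1 * lead_coef r = 1 by rewrite -lead_coefM -pE p_monic.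
move=> /(congr1 Num.norm); rewrite normrM normr1 => lE.
have [lp1 lr] : `|lead_coef p1| = 1 /\ `|lead_coef r| = 1.
  by move: lE; rewrite -!abszE -PoszM => -[] /eqP; rewrite muln_eq1 => /andP[/eqP-> /eqP->].
have c12 : `|p1`_0| * `|r`_0| = 2.
  by rewrite -normrM -coef0M -pE char_poly_det normrM normrX normrN1 expr1n mul1r.
have rootp z : root (map_poly intr p1 * map_poly intr r) z -> 1 < `|z : R[i]|.
  by rewrite -rmorphM -pE; exact: expanding_root.
have gt1 (s : {poly int}) : `|lead_coef s| = 1 ->
    (forall z : R[i], root (map_poly intr s) z -> 1 < `|z|) ->
    (size s <= 1)%N \/ 1 < `|s`_0|.
  move=> ls sr; case: (leqP (size s) 1) => [|s1]; [by left|right].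
  exact: int_poly_coef0_gt1 s1 sr.
have [z rz|s1|c1] := gt1 p1 lp1.
- by apply: rootp; rewrite rootM rz.
- move: sq; rewrite qE size_scale // size_rat_int_poly.
  have : p1 != 0 by rewrite -lead_coef_eq0 -normr_eq0 lp1.
  by rewrite -size_poly_gt0 => p10; rewrite eqn_leq s1 p10.
have [z rz|s1|c2] := gt1 r lr.
- by apply: rootp; rewrite rootM rz orbT.
- rewrite pE rmorphM /= qE.
  have r0 : r != 0 by rewrite -lead_coef_eq0 -normr_eq0 lr.
  have [c c0 rE] : exists2 c : int, c != 0 & r = c%:P.
    exists r`_0; last by apply: size1_polyC.
    by move: r0; rewrite {1}(size1_polyC s1) polyC_eq0.
  rewrite rE map_polyC /= mulrC mul_polyC eqp_sym.
  apply: (eqp_trans (eqp_scale _ _)); first by rewrite intr_eq0.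
  by rewrite eqp_sym eqp_scale.
have prod2 (x y : int) : 1 < x -> 1 < y -> x * y <> 2 by nia.
by case: (prod2 _ _ c1 c2).
Qed.

(** The columns are [v, A v, ..., A^(d-1) v]; over a field the matrix is invertible exactly when [v]
    is a cyclic vector. *)
Definition krylov (T : pzRingType) (d : nat) (A : 'M[T]_d) (v : 'cV[T]_d) : 'M[T]_d :=
  \matrix_(i, j) (A ^+ j *m v) i 0.

Lemma map_mx_exp (aR rR : pzRingType) (f : {rmorphism aR -> rR}) (d : nat) (A : 'M[aR]_d) k :
  map_mx f (A ^+ k) = map_mx f A ^+ k.
Proof.
elim: k => [|k IH]; first by rewrite !expr0 map_mx1.
by rewrite !exprS map_mxM IH.
Qed.

Lemma map_krylov (aR rR : pzRingType) (f : {rmorphism aR -> rR}) (d : nat) (A : 'M[aR]_d) v :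
  map_mx f (krylov A v) = krylov (map_mx f A) (map_mx f v).
Proof.
by apply/matrixP => i j; rewrite mxE [in LHS]mxE [RHS]mxE -map_mx_exp -map_mxM [RHS]mxE.
Qed.

(** Reads a coefficient vector as a polynomial, so that a linear relation among the columns becomes
    a polynomial in [A] that kills [v]. *)
Lemma krylov_mul (T : comNzRingType) (d : nat) (A : 'M[T]_d.+1) (v c : 'cV[T]_d.+1) :
  krylov A v *m c = horner_mx A (rVpoly c^T) *m v.
Proof.
rewrite /rVpoly poly_def raddf_sum /= mulmx_suml.
apply/colP => i; rewrite mxE summxE; apply: eq_bigr => k _.
rewrite insubT //= => kd; rewrite linearZ /= rmorphXn /= horner_mx_X -scalemxAl.
rewrite [RHS]mxE [X in _ = X * _]mxE mulrC [X in _ * X = _]mxE.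
by congr (c _ _ * _); exact: val_inj.
Qed.

Lemma map_intr_eq0 (F : numDomainType) (d : nat) (v : 'cV[int]_d) :
  map_mx intr v = 0 :> 'cV[F]_d -> v = 0.
Proof.
move=> /matrixP v0; apply/colP => k; have := v0 k 0; rewrite !mxE => /eqP.
by rewrite intr_eq0 => /eqP.
Qed.

(** A relation among the columns is a nonzero [q] of degree less than [d] with [q(M) v = 0]. Being
    coprime to the irreducible characteristic polynomial, it gives [v = 0] by Bezout and
    Cayley-Hamilton. The argument runs over the rationals, and invertibility passes to [F] through
    [ratr]. *)
Lemma krylov_unit (R : realType) (d : nat) (M : 'M[int]_d) (v : 'cV[int]_d) (F : numFieldType) :
  (0 < d)%N -> expanding R M -> `|\det M| = 2 -> v != 0 ->
  krylov (map_mx intr M) (map_mx intr v) \in @unitmx F d.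
Proof.
case: d M v => // d M v _ eM dM v0.
have pirr := expanding_irreducible (ltn0Sn d) eM dM.
pose MQ := map_mx (intr : int -> rat) M; pose vQ := map_mx (intr : int -> rat) v.
suff KQ : krylov MQ vQ \in unitmx.
  have E : (@ratr F) \o intr = intr by apply/funext => n; rewrite /= ratr_int.
  by have := KQ; rewrite -(map_unitmx (@ratr F)) map_krylov -!map_mx_comp E.
rewrite -unitmx_tr -row_free_unit -kermx_eq0; apply/rowV0P => c.
move=> /sub_kermxP /(congr1 trmx); rewrite trmx_mul trmxK trmx0 krylov_mul trmxK => hq.
apply/eqP; apply: contraT => c0; set q := rVpoly c in hq.
have q0 : q != 0 by apply: contra c0 => /eqP q0; rewrite -[c]rVpolyK -/q q0 linear0.
have cop : coprimep q (map_poly intr (char_poly M)).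
  rewrite /coprimep; apply: contraT => sg.
  have [_ /(_ _ sg (dvdp_gcdr _ _))/eqp_size sE] := pirr.
  have := dvdp_leq q0 (dvdp_gcdl q (map_poly intr (char_poly M))).
  rewrite sE size_rat_int_poly size_char_poly => /leq_trans /(_ (size_poly _ _)).
  by rewrite ltnn.
have /Bezout_eq1_coprimepP[[a b] /= ab] := cop.
have := congr1 (fun p => horner_mx MQ p *m vQ) ab.
rewrite /= rmorphD !rmorphM /= map_char_poly Cayley_Hamilton mulr0 addr0 rmorph1.
rewrite -mulmxE -mulmxA hq mulmx0 mul1mx => /esym /map_intr_eq0 vQ0.
by rewrite vQ0 eqxx in v0.
Qed.

(** * The generators of an attractor *)

(* Peeling off one root [z] at a time: [u' = (A - z) u] is killed by the product
   over the other roots, and [B^(j+1) u = z^-1 (B^j u - B^(j+1) u')]. *)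
Lemma expanding_orbit_bounded (C : numFieldType) (d : nat) (A B : 'M[C]_d.+1)
    (s : seq C) (u : 'cV[C]_d.+1) :
  B *m A = 1%:M -> (forall z, z \in s -> 1 < `|z|) ->
  horner_mx A (\prod_(z <- s) ('X - z%:P)) *m u = 0 ->
  exists K : C, forall n, \sum_(j < n) \sum_i `|(B ^+ j *m u) i 0| <= K.
Proof.
move=> BA; elim: s u => [|z s IH] u s1.
  rewrite big_nil rmorph1 mul1mx => ->; exists 0 => n.
  by rewrite big1 // => j _; rewrite mulmx0 big1 // => i _; rewrite mxE normr0.
rewrite big_cons mulrC rmorphM /= -mulmxE -mulmxA => hu.
set u' := _ *m u in hu.
have z1 : 1 < `|z| by apply: s1; rewrite mem_head.
have z0 : z != 0 by rewrite -normr_gt0 (lt_trans ltr01).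
have [|K' hK] := IH u' _ hu.
  by move=> y ys; apply: s1; rewrite in_cons ys orbT.
pose N (y : 'cV[C]_d.+1) : C := \sum_i `|y i 0|.
have rec j : B ^+ j.+1 *m u = z^-1 *: (B ^+ j *m u - B ^+ j.+1 *m u').
  have -> : u' = A *m u - z *: u.
    by rewrite /u' rmorphB /= horner_mx_X horner_mx_C mulmxBl mul_scalar_mx.
  rewrite mulmxBr mulmxA exprSr -mulmxE -(mulmxA _ B A) BA mulmx1.
  by rewrite opprB addrC subrK -scalemxAr scalerA mulVf // scale1r.
have Nrec j : N (B ^+ j.+1 *m u) <= `|z|^-1 * (N (B ^+ j *m u) + N (B ^+ j.+1 *m u')).
  rewrite rec /N -big_split /= mulr_sumr; apply: ler_sum => i _.
  rewrite mxE normrM normfV ler_pM2l ?invr_gt0 ?normr_gt0 //.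
  by rewrite mxE [X in _ + X]mxE ler_normB.
have Nge0 y : 0 <= N y by apply: sumr_ge0 => i _.
pose S n : C := \sum_(j < n) N (B ^+ j *m u).
pose c := `|z|^-1.
have c0 : 0 < c by rewrite invr_gt0 normr_gt0.
have c1 : c < 1 by rewrite invf_lt1 // normr_gt0.
(* This bound solves [S <= N u + c (S + K')] for [S], which is possible because [c < 1]. *)
exists ((N u + c * K') / (1 - c)) => n.
rewrite ler_pdivlMr ?subr_gt0 // -/(S n).
have SS : S n <= S n.+1 by rewrite /S big_ord_recr /= lerDl.
have S1 : S n.+1 <= N u + c * (S n + K').
  rewrite {1}/S big_ord_recl expr0 mul1mx lerD2l.
  apply: (@le_trans _ _ (\sum_(j < n) c * (N (B ^+ j *m u) + N (B ^+ j.+1 *m u')))).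
    by apply: ler_sum => j _; exact: Nrec.
  rewrite -mulr_sumr ler_pM2l // big_split /= lerD2l.
  apply: le_trans (hK n.+1); rewrite big_ord_recl /= lerDr.
  exact: Nge0.
have := le_trans SS S1; rewrite mulrDr addrCA -lerBlDl mulrBr mulr1.
by rewrite (mulrC (S n)).
Qed.

Lemma normc_real (R : realType) (x : R) : `|x%:C%C| = (`|x|)%:C%C.
Proof. by rewrite normc_def /= expr0n /= addr0 sqrtr_sqr. Qed.

Definition orbit (R : realType) (d : nat) (M : 'M[int]_d) (v : 'cV[int]_d) (j : nat) : 'cV[R]_d :=
  invmx (map_mx intr M) ^+ j.+1 *m map_mx intr v.

Lemma det_map_unit (F : numFieldType) (d : nat) (M : 'M[int]_d) :
  `|\det M| = 2 -> map_mx intr M \in @unitmx F d.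
Proof.
move=> dM; rewrite unitmxE det_map_mx unitfE intr_eq0.
by rewrite -normr_eq0 dM.
Qed.

Lemma bounded_series_cvg (R : realType) (a : nat -> R) (K : R) :
  (forall j, 0 <= a j) -> (forall n, \sum_(j < n) a j <= K) -> cvgn (series a).
Proof.
move=> a0 aK; apply: nondecreasing_is_cvgn.
  by apply/nondecreasing_seqP => n; rewrite seriesSr lerDl.
by exists K => _ [n _ <-]; rewrite /series /= big_mkord.
Qed.

(** By Cayley-Hamilton a product of factors [X - z] with [|z| > 1] kills the vector. The bound is
    obtained over [R[i]], and its real part bounds the real partial sums. *)
Lemma orbit_summable (R : realType) (d : nat) (M : 'M[int]_d) (v : 'cV[int]_d) :
  expanding R M -> `|\det M| = 2 -> summable (orbit R M v).
Proof.
case: d M v => [|d] M v eM dM; first by case.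
pose A : 'M[R[i]]_d.+1 := map_mx intr M; pose B := invmx A.
have AU : A \in unitmx by exact: det_map_unit.
have BA : B *m A = 1%:M by rewrite mulVmx.
have [r rE] := closed_field_poly_normal (char_poly A).
have rE1 : char_poly A = \prod_(z <- r) ('X - z%:P).
  by rewrite {1}rE (eqP (char_poly_monic A)) scale1r.
have r1 z : z \in r -> 1 < `|z|.
  by move=> zr; apply: eM; rewrite eigenvalue_root_char -/A rE1 root_prod_XsubC.
pose u : 'cV[R[i]]_d.+1 := B *m map_mx intr v.
have [|K hK] := expanding_orbit_bounded BA r1 (u := u).
  by rewrite -rE1 Cayley_Hamilton mul0mx.
have wE j : map_mx (real_complex R) (orbit R M v j) = B ^+ j *m u.
  rewrite /orbit /u mulmxA mulmxE -exprSr map_mxM map_mx_exp map_invmx -!map_mx_comp.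
  have E : real_complex R \o intr = intr by apply/funext => n; rewrite /= rmorph_int.
  by rewrite E.
move=> i; apply: (bounded_series_cvg (K := complex.Re K)) => // n.
have : \sum_(j < n) (`|orbit R M v j i 0|)%:C%C <= K.
  apply: le_trans (hK n); apply: ler_sum => j _.
  rewrite -wE; move: (orbit R M v j) => o.
  rewrite (bigD1 i) //= mxE normc_real lerDl.
  exact: sumr_ge0.
by rewrite -rmorph_sum lecE /= => /andP[_].
Qed.

(** * Matrices with a scalar power *)

(** The points [1, ..., size p] are too many roots. Leaving out 0 suits identities in which [x] is a
    denominator. *)
Lemma poly_eq0_nonzero (F : numFieldType) (p : {poly F}) :
  (forall x, x != 0 -> p.[x] = 0) -> p = 0.
Proof.
move=> p0; apply: (@roots_geq_poly_eq0 _ _ [seq k.+1%:R | k <- iota 0 (size p)]).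
- by apply/allP => _ /mapP[k _ ->]; rewrite /root p0 // pnatr_eq0.
- rewrite map_inj_uniq ?iota_uniq // => i j /eqP.
  by rewrite eqr_nat => /eqP[].
- by rewrite size_map size_iota.
Qed.

(* If all roots lie on the circle |z|^2 = c then z -> c / z is conjugation, which
   permutes the roots of a polynomial with integer coefficients. *)
Lemma coef_reciprocal (C : numClosedFieldType) (p : {poly C}) (c : C) (r : seq C) :
  p = \prod_(z <- r) ('X - z%:P) -> map_poly Num.conj p = p ->
  (forall z, z \in r -> `|z| ^+ 2 = c) ->
  forall m, (m <= size r)%N -> p`_m * c ^+ m = p`_0 * p`_(size r - m).
Proof.
move=> pE pconj rc m mr; set d := size r.
have sp : size p = d.+1 by rewrite pE size_prod_XsubC.
(* The polynomial [x^d p(c / x)]: the coefficients of [p] reversed and scaled. *)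
pose q := \poly_(j < d.+1) (p`_(d - j) * c ^+ (d - j)).
have qx x : x != 0 -> q.[x] = x ^+ d * p.[c / x].
  move=> x0; rewrite horner_poly horner_coef sp mulr_sumr (reindex_inj rev_ord_inj) /=.
  apply: eq_bigr => j _; rewrite subSS subKn -1?ltnS // exprMn exprVn.
  rewrite -[in x ^+ d](subnK (_ : j <= d)%N) -1?ltnS // exprD; field.
  by rewrite expf_neq0.
have qp : q = p`_0 *: p.
  apply/eqP; rewrite -subr_eq0; apply/eqP/poly_eq0_nonzero => x x0.
  rewrite !hornerE qx // (_ : p.[x] = (map_poly Num.conj p).[x]); last by rewrite pconj.
  rewrite -horner_coef0 pE rmorph_prod !horner_prod.
  (* Factor by factor: [x (c / x - z) = (- z) (x - conj z)], because [c = z conj z]. *)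
  have cl s : {subset s <= r} -> x ^+ size s * \prod_(z <- s) ('X - z%:P).[c / x] =
      \prod_(z <- s) ('X - z%:P).[0] * \prod_(z <- s) (map_poly Num.conj ('X - z%:P)).[x].
    elim: s => [|z s IH] sr; first by rewrite !big_nil expr0 !mulr1.
    rewrite !big_cons /= exprS [LHS]mulrACA [RHS]mulrACA IH => [|y ys]; last first.
      by apply: sr; rewrite in_cons ys orbT.
    congr (_ * _); rewrite -(rc z (sr z (mem_head _ _))) normCK map_polyXsubC !hornerE; field.
    exact: x0.
  by apply/eqP; rewrite subr_eq0; apply/eqP/cl.
have := congr1 (fun u : {poly C} => u`_(d - m)) qp.
by rewrite coefZ coef_poly ltnS leq_subr subKn.
Qed.

(* For an odd linear coefficient, a power of [y] can be real only if [y] is. *)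
Lemma quadratic_power_odd (C : comNzRingType) (y : C) (b : int) (n : nat) :
  y ^+ 2 = - (2 * b + 1)%:~R * y - 2 ->
  exists r s : int, y ^+ n.+1 = (1 + 2 * r)%:~R * y + (2 * s)%:~R.
Proof.
move=> y2; elim: n => [|n [r [s IH]]].
  by exists 0, 0; ring.
(* Multiplying by [y] and reducing [y ^+ 2] keeps the coefficient of [y] odd and the constant term
   even. *)
exists (- b - 1 - 2 * r * b - r + s), (- (1 + 2 * r)).
have -> : y ^+ n.+2 = (1 + 2 * r)%:~R * y ^+ 2 + (2 * s)%:~R * y.
  by rewrite exprSr IH; ring.
by rewrite y2; ring.
Qed.

(** If [y] were real, [a^2] would be 8. So [y] is not real, its real part is [- a / 2], and
    [|y|^2 = 2] gives [a^2 < 8]. For odd [a] the power [y ^+ n] is an odd multiple of [y] plus an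
    integer, hence not real. *)
Lemma complex_quadratic (R : realType) (y : R[i]) (a : int) (n : nat) (c : R) :
  y ^+ 2 + a%:~R * y + 2 = 0 -> `|y| ^+ 2 = 2 -> (0 < n)%N -> y ^+ n = c%:C%C ->
  a \in [:: - 2; 0; 2].
Proof.
case: n => // n y2 ny _ yn.
have sq8 (k : int) : k * k < 9 -> k = - 2 \/ k = - 1 \/ k = 0 \/ k = 1 \/ k = 2.
  move=> k9; have [k1 k2] : -2 <= k /\ k <= 2 by split; nia.
  lia.
have y20 : y ^+ 2 = - a%:~R * y - 2 by rewrite -(subr0 (y ^+ 2)) -y2; ring.
have intE (k : int) : (k%:~R : R[i]) = (k%:~R : R)%:C%C by rewrite rmorph_int.
have [yr [yi yE]] : exists yr yi : R, y = (yr +i* yi)%C by case: (y) => yr yi; exists yr, yi.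
have twoE : (2 : R[i]) = (2 : R)%:C%C by rewrite rmorph_nat.
have nE : yr ^+ 2 + yi ^+ 2 = 2.
  move: ny; rewrite yE sqr_normc twoE; simpc => -[<- _]; ring.
have [reE imE] : yr ^+ 2 - yi ^+ 2 + a%:~R * yr + 2 = 0 /\ 2 * yr * yi + a%:~R * yi = 0.
  move: y2; rewrite yE intE twoE expr2; simpc => -[h1 h2]; split.
    by rewrite -[RHS]h1; ring.
  by rewrite -[RHS]h2; ring.
have yi0 : yi != 0.
  apply/eqP => yi0; rewrite yi0 in nE reE.
  have ayr : a%:~R * yr = -4 by nra.
  have : (a * a * 2)%:~R = (16%:~R : R) by rewrite !intrM; nra.
  by move/intr_inj => aa; case: (sq8 a) => [|aE|[aE|[aE|[aE|aE]]]]; [lia|subst a..].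
have yrE : 2 * yr + a%:~R = 0.
  by apply/eqP; rewrite -(mulIr_eq0 _ (mulIf yi0)) mulrDl imE.
have a8 : a * a < 8.
  rewrite -(ltr_int R) !intrM.
  have : 0 < yi ^+ 2 by rewrite exprn_even_gt0.
  nra.
have odd_a b : a = 2 * b + 1 -> False.
  move=> aE; rewrite aE in y20.
  have [r [s ynE]] := quadratic_power_odd n y20.
  move: ynE; rewrite yn yE !intE; simpc => -[_] /esym /eqP.
  rewrite mulf_eq0 (negbTE yi0) orbF intr_eq0 => /eqP; lia.
rewrite !inE; case: (sq8 a) => [|->|[aE|[->|[aE|->]]]] //; first lia.
  by case: (odd_a (-1)); rewrite aE.
by case: (odd_a 0); rewrite aE.
Qed.

Lemma charpoly_classification (R : realType) (d : nat) (M : 'M[int]_d) (n : nat) (mu : R) :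
  (0 < d)%N -> (0 < n)%N -> `|\det M| = 2 -> map_mx intr M ^+ n = mu%:M ->
  (exists2 s : int, s \in [:: -1; 1] & char_poly M = 'X^d - (2 * s)%:P) \/
  (exists (k : nat) (s : int), [/\ s \in [:: -1; 1], d = (k * 2)%N &
     char_poly M = 'X^d + (2 * s)%:P * 'X^k + 2%:P]).
Proof.
move=> d0 n0 dM Mn.
pose A : 'M[R[i]]_d := map_mx intr M.
have An : A ^+ n = (mu%:C%C)%:M.
  have E : intr = real_complex R \o intr by apply/funext => k; rewrite /= rmorph_int.
  by rewrite /A E map_mx_comp -map_mx_exp Mn map_scalar_mx.
have [r rE] := closed_field_poly_normal (char_poly A).
have {}rE : char_poly A = \prod_(z <- r) ('X - z%:P).
  by rewrite {1}rE (eqP (char_poly_monic A)) scale1r.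
(* Every eigenvalue has the same [n]-th power [mu], hence the same modulus. *)
have rn z : z \in r -> z ^+ n = mu%:C%C.
  rewrite -root_prod_XsubC -rE -eigenvalue_root_char => /eigenvalueP[v vA v0].
  have vAk k : v *m A ^+ k = z ^+ k *: v.
    elim: k => [|k IH]; first by rewrite !expr0 mulmx1 scale1r.
    by rewrite exprSr -mulmxE mulmxA IH -scalemxAl vA scalerA -exprSr.
  have := vAk n; rewrite An mul_mx_scalar => /eqP; rewrite -subr_eq0 -scalerBl.
  by rewrite scaler_eq0 (negbTE v0) orbF subr_eq0 => /eqP.
have sr : size r = d by have := size_char_poly A; rewrite rE size_prod_XsubC => -[].
have p0E : (char_poly A)`_0 = ((char_poly M)`_0)%:~R by rewrite -map_char_poly coef_map.
have p02 : `|(char_poly M)`_0| = 2.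
  by rewrite char_poly_det normrM normrX normrN1 expr1n mul1r.
case: r rE rn sr => [|z0 r] rE rn sr; first by rewrite -sr in d0.
pose rho : R[i] := `|z0|.
have rrho z : z \in z0 :: r -> `|z| = rho.
  move=> zr; apply/eqP; rewrite -(eqrXn2 n0 (normr_ge0 z) (normr_ge0 z0)).
  by rewrite -!normrX !rn // mem_head.
have rhod : rho ^+ d = 2.
  have : `|(char_poly A)`_0| = 2 by rewrite p0E -intr_norm p02.
  rewrite (norm_coef0_prod (r := z0 :: r)); last first.
    by rewrite (eqP (char_poly_monic A)) scale1r.
  rewrite (eqP (char_poly_monic A)) mul1r normr_prod => <-.
  rewrite -sr; elim: (z0 :: r) rrho => [|y s IH] h; first by rewrite big_nil.
  rewrite big_cons exprS normrN h ?mem_head // IH // => x xs.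
  by apply: h; rewrite in_cons xs orbT.
set p := char_poly M in p0E p02 *.
have recip m : (m <= d)%N -> (p`_m)%:~R * (rho ^+ 2) ^+ m = (p`_0)%:~R * (p`_(d - m))%:~R :> R[i].
  move=> md; have := coef_reciprocal rE _ _ (m := m); rewrite sr.
  rewrite -map_char_poly !coef_map /=; apply=> // [|z zr]; last by rewrite rrho.
  apply/polyP => i; rewrite !coef_map /=; exact: rmorph_int.
(* Norms to the power [d] turn [recip] into an equality of integers; compare the
   exponents of 2. *)
have pm0 m : (0 < m < d)%N -> (m * 2 != d)%N -> p`_m = 0.
  move=> /andP[m0 md] m2; apply/eqP; apply: contraT => pm.
  have := recip m (ltnW md) => /(congr1 (fun x => `|x| ^+ d)) /=.
  have absE (k : int) : `|k%:~R : R[i]| = (absz k)%:R by rewrite -intr_norm -abszE.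
  rewrite !normrM !absE !normrX (ger0_norm (normr_ge0 z0)) -/rho !exprMn.
  rewrite (_ : rho ^+ m ^+ d = 2 ^+ m); last by rewrite -exprM mulnC exprM rhod.
  rewrite -!natrX -!natrM => /eqP.
  rewrite eqr_nat => /eqP ab.
  have p02' : absz p`_0 = 2%N by apply/eqP; rewrite -eqz_nat abszE p02.
  rewrite p02' in ab.
  have a0 : (0 < absz (p`_m)%R)%N by rewrite absz_gt0.
  have b0 : (0 < absz (p`_(d - m))%R)%N.
    rewrite lt0n; apply/eqP => b0; move: ab; rewrite b0 exp0n // muln0 => /eqP.
    by rewrite !muln_eq0 !expn_eq0 (gtn_eqF a0).
  have := congr1 (logn 2) ab.
  rewrite !lognM ?muln_gt0 ?expn_gt0 ?a0 ?b0 // !pfactorK // !lognX.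
  move: (logn 2 _) (logn 2 _) => x y E.
  have /dvdnP[q mq] : (d %| m * 2)%N.
    rewrite muln2 -addnn -(dvdn_addr _ (dvdn_mulr y (dvdnn d))) E.
    by rewrite dvdn_addr ?dvdn_mulr.
  case: q mq => [|[|q]] mq.
  - by move: mq m0; rewrite mul0n; case: (m).
  - by rewrite mq mul1n eqxx in m2.
  - by move: md; rewrite -(ltn_pmul2r (isT : 0 < 2)%N) mq (mulnC d) ltn_mul2r andbF.
have p0pm : p`_0 = 2 \/ p`_0 = - 2.
  by move: p02; move: (p`_0) => x; lia.
have pd1 : p`_d = 1.
  by have := char_poly_monic M; rewrite monicE lead_coefE size_char_poly => /eqP.
have pbig m : (d < m)%N -> p`_m = 0.
  by move=> dm; apply: nth_default; rewrite size_char_poly.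
have [[k [dk pk0]]|nk] := pselect (exists k, d = (k * 2)%N /\ p`_k != 0); last first.
  left; exists (if p`_0 == 2 then -1 else 1); first by case: ifP; rewrite !inE.
  apply/polyP => i; rewrite coefB coefXn coefC.
  have [->|i0] := posnP i.
    by rewrite (ltn_eqF d0) /=; case: p0pm => ->.
  rewrite subr0.
  case: (ltngtP i d) => [id|id|->]; [|exact: pbig|exact: pd1].
  have [i2|/eqP i2] := eqVneq (i * 2)%N d; last by apply: pm0; rewrite ?i0 //; exact/eqP.
  by apply/eqP; apply: contraT => pi; case: nk; exists i.
right; have k0 : (0 < k)%N by move: d0; rewrite dk; lia.
have kd : (k < d)%N by rewrite dk; lia.
(* At the middle index [recip] compares the coefficient with itself; as it is nonzero,
   [p_0 = rho^d], which fixes the sign. *)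
have p02'' : p`_0 = 2.
  have := recip k (ltnW kd); rewrite -exprM mulnC -dk rhod.
  rewrite (_ : d - k = k)%N; last by rewrite dk; lia.
  rewrite -[2]/(2%:~R) -!intrM => /intr_inj; rewrite mulrC => /(mulIf pk0). by [].
have pE : p = 'X^d + (p`_k)%:P * 'X^k + 2%:P.
  apply/polyP => i; rewrite !coefD coefXn coefCM coefXn coefC.
  have [->|i0] := posnP i.
    by rewrite (ltn_eqF d0) (ltn_eqF k0) mulr0 /= !add0r.
  rewrite addr0.
  case: (ltngtP i d) => [id|id|->]; last by rewrite (gtn_eqF kd) mulr0 addr0.
    rewrite add0r; case: (eqVneq i k) => [->|ik]; first by rewrite mulr1.
    by rewrite mulr0; apply: pm0; [rewrite i0|rewrite dk eqn_pmul2r].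
  by rewrite pbig // gtn_eqF ?mulr0 ?addr0 // (ltn_trans kd).
have [a aE] : exists a, a = p`_k by exists p`_k.
rewrite -aE in pk0 pE.
(* [z0 ^+ k] is a root of [y^2 + a y + 2] with squared modulus [rho^d = 2] and real [n]-th power
   [mu ^+ k]. *)
have ain : a \in [:: - 2; 0; 2].
  have z0k : z0 ^+ d + a%:~R * z0 ^+ k + 2 = 0.
    have : root (char_poly A) z0 by rewrite rE root_prod_XsubC mem_head.
    rewrite -map_char_poly -/p pE /root !rmorphD rmorphM /= !map_polyXn !map_polyC !hornerE /=.
    by rewrite -addrA => /eqP.
  apply: (@complex_quadratic R (z0 ^+ k) _ n (mu ^+ k)) => //.
  - by rewrite -exprM -dk.
  - by rewrite normrX -/rho -exprM -dk.
  - by rewrite -exprM mulnC exprM rn ?mem_head // rmorphXn.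
exists k, (if a == 2 then 1 else -1); split=> //; first by case: ifP.
rewrite {1}pE; move: ain pk0; rewrite !inE => /or3P[]/eqP-> //.
Qed.

(** * Affine similarity *)

Lemma affinely_similar_trans (R : realType) (d : nat) (A B C : set 'cV[R]_d) :
  affinely_similar A B -> affinely_similar B C -> affinely_similar A C.
Proof.
move=> [L [c [Lu ->]]] [L' [c' [Lu' ->]]]; exists (L' *m L), (L' *m c + c').
rewrite unitmx_mul Lu' Lu; split=> //; apply/seteqP; split=> x.
  by move=> [_ [y Ay <-] <-]; exists y => //; rewrite mulmxDr mulmxA addrA.
by move=> [y Ay <-]; exists (L *m y + c); [exists y|rewrite mulmxDr mulmxA addrA].
Qed.

Lemma affinely_similar_sym (R : realType) (d : nat) (A B : set 'cV[R]_d) :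
  affinely_similar A B -> affinely_similar B A.
Proof.
move=> [L [c [Lu ->]]]; exists (invmx L), (- (invmx L *m c)).
have E y : invmx L *m (L *m y + c) - invmx L *m c = y.
  by rewrite mulmxDr mulmxA mulVmx // mul1mx addrK.
rewrite unitmx_inv; split=> //; apply/seteqP; split=> x.
  by move=> Ax; exists (L *m x + c); [exists x|].
by move=> [_ [y Ay <-] <-]; rewrite E.
Qed.

Lemma affinely_similar_translate (R : realType) (d : nat) (A : set 'cV[R]_d) c :
  affinely_similar A [set x + c | x in A].
Proof.
exists 1%:M, c; rewrite unitmx1; split=> //.
by apply/seteqP; split=> _ [x Ax <-]; exists x; rewrite ?mul1mx.
Qed.

(** Each digit is [d0] or [d0 + (d1 - d0)]: the constant digit [d0] contributes the translation [c],
    and the choices of [d1] a subset sum. *)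
Lemma attractorE (R : realType) (d : nat) (M : 'M[int]_d) (d0 d1 : 'cV[int]_d) :
  expanding R M -> `|\det M| = 2 ->
  exists c, attractor R M [set d0; d1] =
    [set x + c | x in subset_sums (orbit R M (d1 - d0))].
Proof.
move=> eM dM; have [c hc] := summable_has_sum (orbit_summable (v := d0) eM dM).
pose w := orbit R M (d1 - d0).
have oE (b : bool) j : invmx (map_mx intr M : 'M[R]_d) ^+ j.+1
      *m map_mx intr (if b then d1 else d0) = b%:R *: w j + orbit R M d0 j.
  case: b; last by rewrite scale0r add0r.
  by rewrite scale1r /w /orbit -mulmxDr map_mxB subrK.
exists c; apply/seteqP; split=> x.
  move=> [a [aD hx]]; pose e j := a j == d1 .
  have aE j : a j = if e j then d1 else d0.
    by rewrite /e; case: (aD j) => /= ->; case: eqP.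
  have h : has_sum (fun j => (e j)%:R *: w j + orbit R M d0 j) x.
    have : has_sum (fun j => invmx (map_mx intr M : 'M[R]_d) ^+ j.+1
                        *m map_mx intr (a j)) x by exact: hx.
    by congr has_sum; apply/funext => j; rewrite aE oE.
  exists (x - c); last by rewrite subrK.
  exists e; have := has_sumB h hc; congr has_sum; apply/funext => j.
  by rewrite addrK.
move=> [y [e hy] <-]; exists (fun j => if e j then d1 else d0); split.
  by move=> j; case: (e j); [right|left].
suff : has_sum (fun j => invmx (map_mx intr M : 'M[R]_d) ^+ j.+1
    *m map_mx intr (if e j then d1 else d0)) (y + c) by [].
have := has_sumD hy hc; congr has_sum; apply/funext => j.
by rewrite oE.
Qed.

(** Reversing a generator and complementing its coefficient changes a sum by that generator. The sum
    of all reversed generators is therefore a translation vector, and signs can be chosen at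
    will. *)
Lemma subset_sums_flip (R : realType) (d : nat) (w : nat -> 'cV[R]_d) (s : nat -> bool) :
  summable w -> affinely_similar (subset_sums (fun j => (-1) ^+ s j *: w j)) (subset_sums w).
Proof.
move=> sw; have [c hc] := summable_coef01 (fun j => bool01 R (s j)) sw.
have flipE (b b' : bool) (y : 'cV[R]_d) :
    (b (+) b')%:R *: y = b%:R *: ((-1) ^+ b' *: y) + b'%:R *: y.
  by case: b; case: b'; rewrite /= ?expr0 ?expr1 ?scale1r ?scale0r ?scaleN1r ?addNr ?addr0 ?add0r.
rewrite (_ : subset_sums w =
    [set x + c | x in subset_sums (fun j => (-1) ^+ s j *: w j)]).
  exact: affinely_similar_translate.
apply/seteqP; split=> x.
  move=> [e hx]; exists (x - c); last by rewrite subrK.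
  exists (fun j => e j (+) s j); have := has_sumB hx hc; congr has_sum.
  apply/funext => j; apply/eqP; rewrite subr_eq -flipE.
  by rewrite -addbA addbb addbF.
move=> [y [e hy] <-]; exists (fun j => e j (+) s j).
have := has_sumD hy hc; congr has_sum; apply/funext => j.
by rewrite flipE.
Qed.

Lemma subset_sums_mul (R : realType) (d e : nat) (L : 'M[R]_(e, d)) (w : nat -> 'cV[R]_d) :
  summable w -> subset_sums (fun j => L *m w j) = [set L *m x | x in subset_sums w].
Proof.
move=> sw; apply/seteqP; split=> x.
  move=> [b hx]; have [y hy] := summable_coef01 (fun j => bool01 R (b j)) sw.
  exists y; first by exists b.
  apply/esym/(has_sum_unique hx); have := has_sum_mul (A := L) hy.
  by congr has_sum; apply/funext => j; rewrite scalemxAr.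
move=> [y [b hy] <-]; exists b; have := has_sum_mul (A := L) hy.
by congr has_sum; apply/funext => j; rewrite scalemxAr.
Qed.

Lemma cvg_muln_oo (k : nat) : (0 < k)%N -> (fun n => (n * k)%N) @ \oo --> \oo.
Proof.
move=> k0; apply/cvgnyPge => A; near=> n.
rewrite (@leq_trans n) ?leq_pmulr //.
by near: n; exact: nbhs_infty_ge.
Unshelve. all: by end_near. Qed.

(** The partial sum up to [n * k] splits exactly into the partial sums up to [n] of the [k] residue
    classes; the limit is taken along multiples of [k]. *)
Lemma has_sum_regroup (R : realType) (d k : nat) (x : nat -> 'cV[R]_d) (s : 'cV[R]_d)
    (t : 'I_k -> 'cV[R]_d) :
  (0 < k)%N -> has_sum x s ->
  (forall i : 'I_k, has_sum (fun l => x (l * k + i)%N) (t i)) -> s = \sum_i t i.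
Proof.
move=> k0 hx ht; apply/colP => m.
have h1 : (fun n => series (fun j => x j m 0) (n * k)%N) @ \oo --> s m 0.
  by move/has_sumP: hx => /(_ m) /(cvg_comp _ _ (cvg_muln_oo k0)).
have h2 : (fun n => \sum_(i < k) series (fun l => x (l * k + i)%N m 0) n) @ \oo -->
    (\sum_i t i) m 0.
  by rewrite summxE; apply: cvg_sumr => i; have /has_sumP := ht i.
rewrite (_ : (fun n => _) = fun n => series (fun j => x j m 0) (n * k)%N) in h2.
  exact: (cvg_unique _ h1 h2).
apply/funext => n; rewrite /series /= exchange_big /=.
elim: n => [|n IH]; first by rewrite mul0n !big_geq.
rewrite big_nat_recr //= IH mulSn addnC (big_cat_nat _ (leq_addr _ _)) //=; congr (_ + _).
rewrite -{2}[(n * k)%N]add0n big_addn addKn big_mkord.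
by apply: eq_bigr => i _; rewrite addnC.
Qed.

(** * Parallelepipeds *)

Lemma unitmx_inj (F : fieldType) (d : nat) (W : 'M[F]_d) :
  (forall x : 'cV_d, W *m x = 0 -> x = 0) -> W \in unitmx.
Proof.
move=> Winj; rewrite -unitmx_tr -row_free_unit -kermx_eq0; apply/rowV0P => c.
move=> /sub_kermxP /(congr1 trmx); rewrite trmx_mul trmxK trmx0 => /Winj.
by move=> /(congr1 trmx); rewrite trmxK trmx0.
Qed.

Definition free_upto (R : realType) (d : nat) (w : nat -> 'cV[R]_d) (n : nat) : Prop :=
  forall a : nat -> R, \sum_(j < n) a j *: w j = 0 -> forall j, (j < n)%N -> a j = 0.

Definition colsmx (R : realType) (d n : nat) (w : nat -> 'cV[R]_d) : 'M[R]_(d, n) :=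
  \matrix_(i, j) w j i 0.

Lemma colsmx_mul (R : realType) (d n : nat) (w : nat -> 'cV[R]_d) (x : 'cV[R]_n) :
  colsmx n w *m x = \sum_j x j 0 *: w j.
Proof.
apply/colP => i; rewrite mxE summxE; apply: eq_bigr => j _.
by rewrite !mxE mulrC.
Qed.

Lemma colsmx_unit (R : realType) (d : nat) (w : nat -> 'cV[R]_d) :
  free_upto w d -> colsmx d w \in unitmx.
Proof.
move=> wf; apply: unitmx_inj => x; rewrite colsmx_mul => wx.
pose a j := oapp (x^~ 0) 0 (insub j : option 'I_d).
apply/colP => j; rewrite mxE; have := wf a _ j (ltn_ord j).
rewrite /a valK /=; apply; rewrite -[RHS]wx; apply: eq_bigr => i _.
by rewrite valK.
Qed.

(** Greedy digits: [r n] is the remainder after [n] digits, scaled by [2^n], and it stays in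
    [[0, 2]]. The bound is 2 because the weights start at [2^0]. *)
Lemma binary_expansion (R : realType) (t : R) :
  0 <= t <= 2 ->
  exists b : nat -> bool, series (fun l => (b l)%:R * 2^-1 ^+ l) @ \oo --> t.
Proof.
move=> t02.
pose step (r : R) := 2 * (r - (1 <= r)%R%:R).
pose r n := iter n step t.
have r02 n : 0 <= r n <= 2.
  elim: n => [//|n]; rewrite /r iterS -/(r n) /step => /andP[r0 r2].
  by case: (leP 1 (r n)) => r1 /=; apply/andP; split; lra.
exists (fun n => 1 <= r n).
have sE n : series (fun l => (1 <= r l)%R%:R * 2^-1 ^+ l) n = t - r n * 2^-1 ^+ n.
  elim: n => [|n IH]; first by rewrite /series /= big_geq // expr0 mulr1 subrr.
  rewrite seriesSr IH {3}/r iterS -/(r n) /step exprS; by field.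
have g0 : (fun n => t - 2 * 2^-1 ^+ n) @ \oo --> t.
  rewrite -[X in _ --> X]subr0; apply: cvgB; first exact: cvg_cst.
  have : `|2^-1 : R| < 1 by rewrite ger0_norm; lra.
  exact: cvg_geometric.
apply: (squeeze_cvgr _ g0 (cvg_cst t)); apply: nearW => n.
have /andP[r0 r2] := r02 n; rewrite sE.
have p0 : 0 <= (2^-1 : R) ^+ n by apply: exprn_ge0; lra.
by apply/andP; split; nra.
Qed.

Lemma binary_series_bound (R : realType) (b : nat -> bool) (t : R) :
  series (fun l => (b l)%:R * 2^-1 ^+ l) @ \oo --> t -> 0 <= t <= 2.
Proof.
move=> bt.
have p0 n : 0 <= (2^-1 : R) ^+ n by apply: exprn_ge0; lra.
have sE n : 0 <= series (fun l => (b l)%:R * (2^-1 : R) ^+ l) n <= 2 - 2 * 2^-1 ^+ n.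
  elim: n => [|n /andP[IH1 IH2]].
    by rewrite /series /= big_geq // expr0; lra.
  have := p0 n; rewrite seriesSr exprS; case: (b n) => /= pn; apply/andP; split; lra.
apply/andP; split; rewrite -(cvg_lim _ bt) //.
  apply: limr_ge; first by apply/cvg_ex; exists t.
  by apply: nearW => n; have /andP[] := sE n.
apply: limr_le; first by apply/cvg_ex; exists t.
by apply: nearW => n; have /andP[] := sE n; have := p0 n; lra.
Qed.

Lemma has_sum_scalar (R : realType) (d : nat) (a : nat -> R) (t : R) (v : 'cV[R]_d) :
  series a @ \oo --> t -> has_sum (fun l => a l *: v) (t *: v).
Proof.
move=> at_; apply/has_sumP => i; rewrite mxE.
rewrite (_ : series _ = fun n => series a n * v i 0); first exact: cvgMr_tmp.
by apply/funext => n; rewrite /series /= mulr_suml; apply: eq_bigr => j _; rewrite mxE.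
Qed.

(** The class of [i] modulo [d] consists of [w i, w i / 2, w i / 4, ...], whose subset sums fill the
    segment from 0 to [2 w i]; hence the factor 2 in the map from the cube. *)
Lemma halving_parallelepiped (R : realType) (d : nat) (w : nat -> 'cV[R]_d) :
  (0 < d)%N -> summable w -> (forall j, w (j + d)%N = 2^-1 *: w j) -> free_upto w d ->
  is_parallelepiped (subset_sums w).
Proof.
move=> d0 sw wd wf; pose W := colsmx d w.
have wl l i : w (l * d + i)%N = 2^-1 ^+ l *: w i.
  elim: l => [|l IH]; first by rewrite mul0n add0n expr0 scale1r.
  by rewrite mulSn -addnA addnC wd IH scalerA exprS.
have WE (x : 'cV[R]_d) : (2 *: W) *m x + 0 = \sum_(i < d) (2 * x i 0) *: w i.
  rewrite addr0 -scalemxAl colsmx_mul scaler_sumr.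
  by apply: eq_bigr => i _; rewrite scalerA.
exists (2 *: W), 0; split.
  by rewrite unitmxZ ?colsmx_unit // unitfE pnatr_eq0.
apply/seteqP; split=> x.
  move=> [e hx].
  have cv (i : 'I_d) : cvgn (series (fun l => (e (l * d + i)%N)%:R * (2^-1 : R) ^+ l)).
    have g : cvgn (series (geometric (1 : R) 2^-1)).
      by apply: is_cvg_geometric_series; rewrite ger0_norm; lra.
    have p0 n : 0 <= (2^-1 : R) ^+ n by apply: exprn_ge0; lra.
    apply: (series_le_cvg _ _ _ g) => l /=; rewrite ?mulr_ge0 ?mul1r //.
    by rewrite ler_piMl //; case: (e _).
  pose t i := limn (series (fun l => (e (l * d + i)%N)%:R * (2^-1 : R) ^+ l)).
  exists (\col_i (t i / 2)) => /=.
    by move=> i; rewrite mxE; have := binary_series_bound (cv i); rewrite -/(t i); lra.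
  rewrite WE; apply/esym.
  rewrite (has_sum_regroup (t := fun i : 'I_d => t i *: w i) d0 hx) => [|i].
    by apply: eq_bigr => i _; rewrite mxE; congr (_ *: _); field.
  have := has_sum_scalar (v := w i) (cv i); congr has_sum; apply/funext => l.
  by rewrite wl scalerA.
move=> [y y01 <-]; rewrite WE.
have bex (i : 'I_d) : exists b : nat -> bool,
    series (fun l => (b l)%:R * 2^-1 ^+ l) @ \oo --> 2 * y i 0.
  by apply: binary_expansion; have := y01 i; lra.
have [b bE] := choice bex.
(* Index [j] carries digit [j %/ d] of coordinate [j %% d]; the default is never reached, as
   [j %% d < d]. *)
pose e j := oapp (fun i : 'I_d => b i (j %/ d)%N) false (insub (j %% d)%N).
have [s hs] := summable_coef01 (fun j => bool01 R (e j)) sw.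
exists e; rewrite -(has_sum_regroup (t := fun i : 'I_d => (2 * y i 0) *: w i) d0 hs) // => i.
have := has_sum_scalar (v := w i) (bE i); congr has_sum; apply/funext => l.
rewrite wl scalerA /e; congr ((_ : bool)%:R * _ *: _).
rewrite modnMDl modn_small // valK /= divnMDl // divn_small // addn0 //.
Qed.

(** * Dragons *)

Lemma ord2_ind (P : 'I_2 -> Prop) : P 0 -> P 1 -> forall i, P i.
Proof.
move=> P0 P1 [[|[|//]] i2].
  by rewrite (_ : Ordinal i2 = 0) //; exact: val_inj.
by rewrite (_ : Ordinal i2 = 1) //; exact: val_inj.
Qed.

(* The coordinates of [M^-l v] in the basis [(v, M^-1 v)] when [M^2 - 2 M + 2 = 0]. *)
Definition dragon_gen (R : realType) (l : nat) : 'cV[R]_2 :=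
  iter l (fun c : 'cV[R]_2 => \col_i (if i == 0 then - c 1 0 / 2 else c 0 0 + c 1 0))
    (\col_i (i == 0)%:R).

Lemma dragon_genS (R : realType) (l : nat) :
  dragon_gen R l.+1 0 0 = - dragon_gen R l 1 0 / 2 /\
  dragon_gen R l.+1 1 0 = dragon_gen R l 0 0 + dragon_gen R l 1 0.
Proof. by rewrite /dragon_gen iterS !mxE. Qed.

Lemma dragon_gen0 (R : realType) : dragon_gen R 0 0 0 = 1 /\ dragon_gen R 0 1 0 = 0.
Proof. by rewrite /dragon_gen /= !mxE. Qed.

Lemma dragon_gen_rec (R : realType) (l : nat) :
  dragon_gen R l.+2 = dragon_gen R l.+1 - 2^-1 *: dragon_gen R l.
Proof.
have [x1 y1] := dragon_genS R l; have [x2 y2] := dragon_genS R l.+1.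
apply/colP; apply: ord2_ind; rewrite [RHS]mxE [X in _ + X]mxE [X in - X]mxE.
  by rewrite x2 x1 y1; field.
by rewrite y2 x1 y1; field.
Qed.

(** The roots of [z^2 - 2 z + 2] are [1 + i] and [1 - i], whose fourth powers are [- 4]. *)
Lemma dragon_gen4 (R : realType) (l : nat) :
  dragon_gen R (4 + l) = - 4^-1 *: dragon_gen R l.
Proof. by rewrite !dragon_gen_rec; apply/colP => i; rewrite !mxE; field. Qed.

Lemma dragon_gen_summable (R : realType) : summable (dragon_gen R).
Proof.
move=> i; pose a j : R := `|dragon_gen R j i 0|.
(* Four steps divide the absolute values by 4, so the sum is at most the first four terms plus a
   quarter of itself; [4 / 3] is [1 / (1 - 1 / 4)]. *)
apply: (@bounded_series_cvg _ _ (4 / 3 * \sum_(j < 4) a j)) => // n.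
have : \sum_(j < n) a j <= \sum_(j < 4 + n) a j.
  by rewrite addnC big_split_ord /= lerDl; apply: sumr_ge0 => j _; exact: normr_ge0.
rewrite big_split_ord /=; have -> : \sum_(j < n) a (4 + j)%N = 4^-1 * \sum_(j < n) a j.
  rewrite mulr_sumr; apply: eq_bigr => j _.
  rewrite /a dragon_gen4; move: (dragon_gen R j) => y.
  have q0 : 0 <= (4^-1 : R) by lra.
  by rewrite mxE normrM normrN (ger0_norm q0).
by rewrite /=; lra.
Qed.

(** Along a residue class modulo [k] the recurrence is that of [dragon_gen], so the class is
    determined by its first two members. *)
Lemma dragon_gen_expand (R : realType) (d k : nat) (w : nat -> 'cV[R]_d) :
  (forall j, w (j + k * 2)%N = w (j + k)%N - 2^-1 *: w j) ->
  forall l i, w (l * k + i)%N = dragon_gen R l 0 0 *: w i + dragon_gen R l 1 0 *: w (k + i)%N.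
Proof.
move=> wrec l i.
suff [//] : w (l * k + i)%N = dragon_gen R l 0 0 *: w i + dragon_gen R l 1 0 *: w (k + i)%N /\
    w (l.+1 * k + i)%N = dragon_gen R l.+1 0 0 *: w i + dragon_gen R l.+1 1 0 *: w (k + i)%N.
elim: l => [|l [IH1 IH2]]; split=> //.
- by have [-> ->] := dragon_gen0 R; rewrite mul0n add0n scale1r scale0r addr0.
- have [-> ->] := dragon_genS R 0; have [-> ->] := dragon_gen0 R.
  by rewrite mul1n oppr0 mul0r scale0r add0r addr0 scale1r.
rewrite (_ : (l.+2 * k + i = (l * k + i) + k * 2)%N); last by lia.
rewrite wrec IH1 (_ : (l * k + i + k = l.+1 * k + i)%N) ?IH2; last by lia.
have E (b : 'I_2) : dragon_gen R l.+2 b 0 = dragon_gen R l.+1 b 0 - 2^-1 * dragon_gen R l b 0.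
  by rewrite dragon_gen_rec mxE [X in _ + X]mxE [X in - X]mxE.
by rewrite !E !scalerBl scalerDr !scalerA opprD addrACA.
Qed.

Lemma sum_mxvec_index (V : nmodType) (m n : nat) (F : 'I_(m * n) -> V) :
  \sum_c F c = \sum_i \sum_j F (mxvec_index i j).
Proof.
rewrite pair_bigA /= (reindex _ (curry_mxvec_bij m n)).
by apply: eq_bigr => -[i j] _.
Qed.

Lemma sum_double (V : nmodType) (k : nat) (F : nat -> V) :
  \sum_(j < k * 2) F j = \sum_(i < k) F i + \sum_(i < k) F (k + i)%N.
Proof. by rewrite (_ : (k * 2 = k + k)%N) ?big_split_ord // muln2 addnn. Qed.

Definition planar_coord (R : realType) (k : nat) (x : 'cV[R]_(k * 2)) (i : 'I_k) : 'cV[R]_2 :=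
  \col_(j < 2) x (mxvec_index i j) 0.

Lemma planar_coordP (R : realType) (k : nat) (x y : 'cV[R]_(k * 2)) :
  (forall i, planar_coord x i = planar_coord y i) -> x = y.
Proof.
move=> xy; apply/colP => c; case: (mxvec_indexP c) => i j.
by have := xy i => /colP /(_ j); rewrite !mxE.
Qed.

Definition planar_col (R : realType) (k : nat) (y : 'I_k -> 'cV[R]_2) : 'cV[R]_(k * 2) :=
  (mxvec (\matrix_(i, j) y i j 0))^T.

Lemma planar_colK (R : realType) (k : nat) (y : 'I_k -> 'cV[R]_2) i :
  planar_coord (planar_col y) i = y i.
Proof. by apply/colP => j; rewrite !mxE mxvecE mxE. Qed.

(** [Li i] maps the model plane to the span of [w i] and [w (k + i)] and carries [dragon_gen] to the
    residue class of [i]. The [Li] combine into [L], invertible because the first [2k] generators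
    are independent. *)
Lemma dragon_product_structure (R : realType) (k : nat) (w : nat -> 'cV[R]_(k * 2)) :
  (0 < k)%N -> summable w ->
  (forall j, w (j + k * 2)%N = w (j + k)%N - 2^-1 *: w j) -> free_upto w (k * 2) ->
  affinely_similar (planar_product (fun _ : 'I_k => subset_sums (dragon_gen R)))
    (subset_sums w).
Proof.
move=> k0 sw wrec wf.
pose L : 'M[R]_(k * 2) := \matrix_(r, c) (mxvec (\matrix_(i < k, b < 2) w (b * k + i)%N r 0)) 0 c.
pose Li (i : 'I_k) : 'M[R]_(k * 2, 2) := \matrix_(r, b) w (b * k + i)%N r 0.
have LE x : L *m x = \sum_i Li i *m planar_coord x i.
  apply/colP => r; rewrite mxE sum_mxvec_index summxE; apply: eq_bigr => i _.
  by rewrite mxE; apply: eq_bigr => b _; rewrite !mxE mxvecE mxE.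
have LiE (i : 'I_k) y : Li i *m y = y 0 0 *: w i + y 1 0 *: w (k + i)%N.
  apply/colP => r; rewrite !mxE big_ord_recl big_ord1 !mxE mul0n mul1n add0n.
  by rewrite mulrC [X in _ + X]mulrC; congr (_ + y _ 0 * _); exact: val_inj.
have wL l (i : 'I_k) : w (l * k + i)%N = Li i *m dragon_gen R l.
  by rewrite LiE (dragon_gen_expand wrec).
have Lu : L \in unitmx.
  apply: unitmx_inj => x; rewrite LE => Lx.
  (* Reorders the coordinates from pairs [(i, b)] to the generator indices [b * k + i]. *)
  pose a j := if (j < k)%N then oapp (fun i : 'I_k => planar_coord x i 0 0) 0 (insub j)
              else oapp (fun i : 'I_k => planar_coord x i 1 0) 0 (insub (j - k)%N).
  have a0 j : (j < k * 2)%N -> a j = 0.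
    apply: wf; rewrite -[RHS]Lx (eq_bigr _ (fun i _ => LiE i _)) big_split /=.
    rewrite (sum_double k (fun j => a j *: w j)); congr (_ + _);
      apply: eq_bigr => i _; rewrite /a.
      by rewrite ltn_ord valK.
    by rewrite ltnNge leq_addr /= addKn valK.
  have lt_i (i : 'I_k) := ltn_ord i.
  apply: planar_coordP => i; rewrite (_ : planar_coord 0 i = 0); last first.
    by apply/colP => b; rewrite !mxE.
  apply/colP; apply: ord2_ind; rewrite [RHS]mxE.
    by have := a0 i; rewrite /a ltn_ord valK /=; apply; have := lt_i i; lia.
  have := a0 (k + i)%N; rewrite /a [(k + i < k)%N]ltnNge leq_addr /= addKn valK /=; apply.
  by have := lt_i i; lia.
exists L, 0; split=> //; apply/seteqP; split=> x.
  move=> [e hx].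
  have yex (i : 'I_k) : exists y, has_sum (fun l => (e (l * k + i)%N)%:R *: dragon_gen R l) y.
    by apply: summable_coef01 (@dragon_gen_summable R) => l; exact: bool01.
  have [y yE] := choice yex.
  exists (planar_col y) => [i|].
    by rewrite -/(planar_coord _ _) planar_colK; eexists; exact: yE.
  rewrite addr0 LE; apply/esym.
  rewrite (has_sum_regroup (t := fun i : 'I_k => Li i *m y i) k0 hx).
    by apply: eq_bigr => i _; rewrite planar_colK.
  move=> i; have := has_sum_mul (A := Li i) (yE i); congr has_sum; apply/funext => l.
  by rewrite wL scalemxAr.
move=> [y yK <-]; rewrite addr0 LE.
have [b bE] := choice yK.
pose e j := oapp (fun i : 'I_k => b i (j %/ k)%N) false (insub (j %% k)%N).
have [s hs] := summable_coef01 (fun j => bool01 R (e j)) sw.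
exists e; rewrite -(has_sum_regroup (t := fun i => Li i *m planar_coord y i) k0 hs) // => i.
have := has_sum_mul (A := Li i) (bE i); congr has_sum; apply/funext => l.
rewrite wL -scalemxAr /e; congr ((_ : bool)%:R *: _).
by rewrite modnMDl modn_small // valK /= divnMDl // divn_small // addn0.
Qed.

(** * Powers of the matrix acting on the generators *)

Lemma expmx_mul (T : pzRingType) (d n : nat) (A : 'M[T]_d) a b (x : 'M[T]_(d, n)) :
  A ^+ a *m (A ^+ b *m x) = A ^+ (a + b) *m x.
Proof. by rewrite mulmxA mulmxE -exprD. Qed.

Lemma map_mx_expK (R : realType) (d : nat) (M : 'M[int]_d) (k : nat) :
  `|\det M| = 2 -> (map_mx intr M : 'M[R]_d) ^+ k *m invmx (map_mx intr M) ^+ k = 1%:M.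
Proof.
move=> dM; elim: k => [|k IH]; first by rewrite !expr0 mul1mx.
rewrite exprSr exprS -!mulmxE mulmxA -(mulmxA _ (map_mx _ _)) mulmxV ?det_map_unit //.
by rewrite mulmx1.
Qed.

Lemma orbit_shift (R : realType) (d : nat) (M : 'M[int]_d) (v : 'cV[int]_d) (j k : nat) :
  `|\det M| = 2 -> (map_mx intr M : 'M[R]_d) ^+ k *m orbit R M v (j + k)%N = orbit R M v j.
Proof.
move=> dM; rewrite /orbit -addSn addnC exprD mulmxA -mulmxE mulmxA.
by rewrite map_mx_expK // mul1mx.
Qed.

Lemma orbit_shift0 (R : realType) (d : nat) (M : 'M[int]_d) (v : 'cV[int]_d) (k : nat) :
  `|\det M| = 2 -> (map_mx intr M : 'M[R]_d) ^+ k.+1 *m orbit R M v k = map_mx intr v.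
Proof. by move=> dM; rewrite /orbit mulmxA map_mx_expK // mul1mx. Qed.

(** Multiplication by [M^d] turns the first [d] generators into [M^(d-1) v, ..., v], the columns of
    the Krylov matrix in reverse order; this explains [rev_ord]. *)
Lemma orbit_free (R : realType) (d : nat) (M : 'M[int]_d) (v : 'cV[int]_d) :
  expanding R M -> `|\det M| = 2 -> v != 0 -> free_upto (orbit R M v) d.
Proof.
case: d M v => // d M v eM dM v0 a aw0 j jd.
pose A : 'M[R]_d.+1 := map_mx intr M.
have Ku := krylov_unit R (ltn0Sn d) eM dM v0.
pose c : 'cV[R]_d.+1 := \col_i a (rev_ord i).
have Kc : krylov A (map_mx intr v) *m c = 0.
  have := congr1 (mulmx (A ^+ d.+1)) aw0; rewrite mulmx0 => <-.
  rewrite (_ : krylov _ _ = colsmx d.+1 (fun j => A ^+ j *m map_mx intr v)); last first.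
    by apply/matrixP => i k; rewrite !mxE.
  rewrite colsmx_mul mulmx_sumr (reindex_inj rev_ord_inj) /=; apply: eq_bigr => i _.
  rewrite mxE rev_ordK -scalemxAr; congr (_ *: _).
  rewrite subSS -(orbit_shift0 R v i dM) expmx_mul.
  by rewrite addnS subnK // -ltnS.
have c0 : c = 0 by rewrite -[c](mulKmx Ku) Kc mulmx0.
have := congr1 (fun y : 'cV_d.+1 => y (rev_ord (Ordinal jd)) 0) c0.
by rewrite /= [RHS]mxE mxE rev_ordK.
Qed.

(** [M^n] commutes with [M], so all [M^j v] are eigenvectors for [mu], and they span the space. *)
Lemma krylov_scalar (R : realType) (d : nat) (M : 'M[int]_d) (v : 'cV[int]_d) n (mu : R) :
  expanding R M -> `|\det M| = 2 -> v != 0 ->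
  (map_mx intr M : 'M[R]_d) ^+ n *m map_mx intr v = mu *: map_mx intr v ->
  (map_mx intr M : 'M[R]_d) ^+ n = mu%:M.
Proof.
case: d M v => [|d] M v eM dM v0 Mnv; first by apply/matrixP; case.
have Ku := krylov_unit R (ltn0Sn d) eM dM v0.
set A : 'M[R]_d.+1 := map_mx intr M in Mnv Ku *.
apply: (can_inj (mulmxK Ku)); rewrite mul_scalar_mx.
have KE : krylov A (map_mx intr v) = colsmx d.+1 (fun j => A ^+ j *m map_mx intr v).
  by apply/matrixP => i k; rewrite !mxE.
apply/matrixP => i j; rewrite KE.
have cE (B : 'M[R]_d.+1) : (B *m colsmx d.+1 (fun j => A ^+ j *m map_mx intr v)) i j =
    (B *m (A ^+ j *m map_mx intr v)) i 0.
  by rewrite !mxE; apply: eq_bigr => l _; rewrite mxE.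
rewrite cE expmx_mul addnC -expmx_mul Mnv -scalemxAr.
by rewrite [LHS]mxE [RHS]mxE [in RHS]mxE.
Qed.

(** A power of [M] moves the relation to [v], which becomes an eigenvector of [M] to the power
    [|i - j|]. *)
Lemma orbit_parallel (R : realType) (d : nat) (M : 'M[int]_d) (v : 'cV[int]_d) i j (mu : R) :
  expanding R M -> `|\det M| = 2 -> v != 0 -> i != j ->
  orbit R M v i = mu *: orbit R M v j ->
  exists n, (0 < n)%N /\ exists mu' : R, (map_mx intr M : 'M[R]_d) ^+ n = mu'%:M.
Proof.
move=> eM dM v0 ij wE.
have step k l (nu : R) : orbit R M v k = nu *: orbit R M v (k + l)%N ->
    (map_mx intr M : 'M[R]_d) ^+ l = nu%:M.
  move=> kl; apply: (krylov_scalar eM dM v0).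
  rewrite -(orbit_shift0 R v (k + l) dM) expmx_mul addnC -expmx_mul orbit_shift //.
  by rewrite kl -scalemxAr.
case: (ltngtP i j) ij => // ij _.
  exists (j - i)%N; rewrite subn_gt0; split=> //; exists mu; apply: (step i).
  by rewrite subnKC // ltnW.
have mu0 : mu != 0.
  apply: contra v0 => /eqP mu0; move: wE; rewrite mu0 scale0r => wi0.
  by have := orbit_shift0 R v i dM; rewrite wi0 mulmx0 => /esym /map_intr_eq0 ->.
exists (i - j)%N; rewrite subn_gt0; split=> //; exists mu^-1; apply: (step j).
by rewrite subnKC ?(ltnW ij) // wE scalerA mulVf // scale1r.
Qed.

Lemma char_poly_zero (R : realType) (d : nat) (M : 'M[int]_d.+1) :
  horner_mx (map_mx intr M : 'M[R]_d.+1) (map_poly intr (char_poly M)) = 0.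
Proof. by rewrite map_char_poly Cayley_Hamilton. Qed.

Lemma summable_sign (R : realType) (d : nat) (w : nat -> 'cV[R]_d) (s : nat -> bool) :
  summable w -> summable (fun j => (-1) ^+ s j *: w j).
Proof. by apply: (summableMl (B := 1)) => j; rewrite normrX normrN1 expr1n. Qed.

Lemma free_sign (R : realType) (d n : nat) (w : nat -> 'cV[R]_d) (s : nat -> bool) :
  free_upto w n -> free_upto (fun j => (-1) ^+ s j *: w j) n.
Proof.
move=> wf a aw j jn.
have E : \sum_(i < n) (a i * (-1) ^+ s i) *: w i = 0.
  by rewrite -[RHS]aw; apply: eq_bigr => i _; rewrite scalerA.
by have /eqP := wf (fun i => a i * (-1) ^+ s i) E j jn; rewrite mulf_eq0 signr_eq0 orbF => /eqP.
Qed.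

(** Cayley-Hamilton makes [M^d] equal to 2 or [- 2]. In the second case the sign of a generator
    changes every [d] steps, and [s] undoes this. *)
Lemma pure_parallelepiped (R : realType) (d : nat) (M : 'M[int]_d) (v : 'cV[int]_d) (b : bool) :
  (0 < d)%N -> expanding R M -> `|\det M| = 2 -> v != 0 ->
  char_poly M = 'X^d - (2 * (-1) ^+ b)%:P ->
  is_parallelepiped (subset_sums (orbit R M v)).
Proof.
case: d M v => // d M v _ eM dM v0 pE; set w := orbit R M v.
have wd j : w (j + d.+1)%N = ((-1) ^+ b / 2) *: w j.
  have := char_poly_zero R M; rewrite pE rmorphB /= map_polyXn map_polyC /=.
  rewrite rmorphB rmorphXn /= horner_mx_X horner_mx_C => /eqP.
  rewrite subr_eq0 => /eqP Md; have := orbit_shift R v j d.+1 dM.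
  rewrite Md mul_scalar_mx -/w => <-; rewrite scalerA rmorphM /= rmorph_sign.
  by rewrite -[LHS]scale1r; congr (_ *: _); case: (b); rewrite ?expr0 ?expr1; field.
pose s j := b && odd (j %/ d.+1).
have sw : summable w by exact: orbit_summable.
apply: (affinely_similar_trans _ (subset_sums_flip s sw)).
apply: halving_parallelepiped => //.
- exact: summable_sign.
- move=> j; rewrite wd /s divnDr // divnn /= addn1 /= !scalerA; congr (_ *: _).
    by case: (b); case: (odd _); rewrite /= ?expr0 ?expr1; field.
- by apply: free_sign; exact: orbit_free.
Qed.

(** Cayley-Hamilton gives the recurrence up to the sign of its first term. For [b = true] the sign
    is already right; for [b = false] it is corrected by reversing the generators in every other
    block of length [k]. *)
Lemma mixed_orbit (R : realType) (k : nat) (M : 'M[int]_(k * 2))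
    (v : 'cV[int]_(k * 2)) (b : bool) :
  (0 < k)%N -> expanding R M -> `|\det M| = 2 -> v != 0 ->
  char_poly M = 'X^(k * 2) + (2 * (-1) ^+ b)%:P * 'X^k + 2%:P ->
  exists s : nat -> bool, let w j := (-1) ^+ s j *: orbit R M v j in
    [/\ summable w, forall j, w (j + k * 2)%N = w (j + k)%N - 2^-1 *: w j,
        free_upto w (k * 2) &
        affinely_similar (subset_sums w) (subset_sums (orbit R M v))].
Proof.
move=> k0 eM dM v0 pE; set w := orbit R M v.
pose A : 'M[R]_(k * 2) := map_mx intr M.
have AE : A ^+ (k * 2) + (2 * (-1) ^+ b) *: A ^+ k + 2%:M = 0.
  rewrite /A; move: (k * 2)%N M pE {eM dM v v0 w A} => n; case: n => [|n] M pE.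
    by apply/matrixP; case.
  have := char_poly_zero R M; rewrite pE rmorphD [in X in X + _]rmorphD rmorphM /=.
  rewrite !map_polyXn !map_polyC /= !rmorphD rmorphM /= !rmorphXn /= !horner_mx_X !horner_mx_C.
  by rewrite -mulmxE mul_scalar_mx rmorphM rmorph_sign.
have wrec j : w (j + k * 2)%N = - (-1) ^+ b *: w (j + k)%N - 2^-1 *: w j.
  have E1 : A ^+ (k * 2) *m w (j + k * 2)%N = w j by exact: orbit_shift.
  have E2 : A ^+ k *m w (j + k * 2)%N = w (j + k)%N.
    by rewrite (_ : (j + k * 2 = j + k + k)%N); [exact: orbit_shift|lia].
  have := congr1 (fun B => B *m w (j + k * 2)%N) AE.
  rewrite mul0mx !mulmxDl -scalemxAl mul_scalar_mx E1 E2.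
  move: (w (j + k * 2)%N) (w (j + k)%N) (w j) => x y z /matrixP E.
  apply/colP => i; have := E i 0; rewrite !mxE; lra.
pose s j := ~~ b && odd (j %/ k).
have sw : summable w by exact: orbit_summable.
exists s; split.
- exact: summable_sign.
- move=> j; rewrite wrec /s !divnDr ?dvdn_mulr // mulKn // divnn k0 addn1 addn2 /= negbK.
    rewrite scalerBr !scalerA.
    by case: (b); case: (odd _); rewrite /= ?expr0 ?expr1; congr (_ *: _ - _ *: _); field.
- by apply: free_sign; exact: orbit_free.
- exact: subset_sums_flip.
Qed.

Lemma mixed_dragon_product (R : realType) (k : nat) (M : 'M[int]_(k * 2))
    (v : 'cV[int]_(k * 2)) (b : bool) :
  (0 < k)%N -> expanding R M -> `|\det M| = 2 -> v != 0 ->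
  char_poly M = 'X^(k * 2) + (2 * (-1) ^+ b)%:P * 'X^k + 2%:P ->
  affinely_similar (planar_product (fun _ : 'I_k => subset_sums (dragon_gen R)))
    (subset_sums (orbit R M v)).
Proof.
move=> k0 eM dM v0 pE; have [s [sw wrec wf sim]] := mixed_orbit k0 eM dM v0 pE.
by apply: affinely_similar_trans sim; exact: dragon_product_structure.
Qed.

(** The case [k = 1], in the plane itself rather than in a product with one factor. *)
Lemma mixed_dragon (R : realType) (M : 'M[int]_2) (v : 'cV[int]_2) (b : bool) :
  expanding R M -> `|\det M| = 2 -> v != 0 ->
  char_poly M = 'X^2 + (2 * (-1) ^+ b)%:P * 'X + 2%:P ->
  affinely_similar (subset_sums (dragon_gen R)) (subset_sums (orbit R M v)).
Proof.
move=> eM dM v0 pE.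
have [s [sw wrec wf sim]] := @mixed_orbit R 1 M v b isT eM dM v0 pE.
apply: affinely_similar_trans sim; set w := (fun j => _) in sw wrec wf *.
exists (colsmx 2 w), 0; split; first exact: colsmx_unit.
have wE : w = fun l => colsmx 2 w *m dragon_gen R l.
  apply/funext => l; have := @dragon_gen_expand R 2 1 w wrec l 0%N.
  rewrite muln1 !addn0 => wl; rewrite wl colsmx_mul big_ord_recl big_ord1.
  by congr (_ + dragon_gen R l _ 0 *: _); exact: val_inj.
rewrite {1}wE subset_sums_mul; last exact: dragon_gen_summable.
by apply/seteqP; split=> _ [x Kx <-]; exists x; rewrite ?addr0.
Qed.

(** * Existence of matrices and digits of both types *)

Lemma exists_char_poly (d : nat) (p : {poly int}) :
  p \is monic -> size p = d.+1 -> exists M : 'M[int]_d, char_poly M = p.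
Proof.
move=> mp sp; have e : (size p).-1 = d by rewrite sp.
by case: _ / e; exists (companionmx p); exact: companionmxK.
Qed.

(** If [M] were onto, it would have an integer right inverse, and 2 would divide 1. *)
Lemma exists_digits (R : realType) (d : nat) (M : 'M[int]_d) :
  expanding R M -> `|\det M| = 2 -> exists d0 d1, generates_two_attractor R M d0 d1.
Proof.
move=> eM dM; have [v Mv] : exists v : 'cV[int]_d, ~ exists z, v = M *m z.
  apply: contrapT => /forallNP H.
  have zex (i : 'I_d) : exists z : 'cV[int]_d, col i 1%:M = M *m z.
    by apply: contrapT; exact: H.
  have [z zE] := choice zex.
  have : M *m (\matrix_(i, j) z j i 0) = 1%:M.
    apply/matrixP => i j; have := congr1 (fun m : 'cV_d => m i 0) (zE j).
    rewrite mxE => ->; rewrite !mxE; apply: eq_bigr => l _; by rewrite mxE.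
  move/(congr1 (fun B => `|\det B|)); rewrite det_mulmx normrM dM det1 normr1.
  move: (`|\det _|) => x; lia.
by exists 0, v; split; rewrite ?subr0.
Qed.

Lemma generator_neq0 (R : realType) (d : nat) (M : 'M[int]_d) (d0 d1 : 'cV[int]_d) :
  generates_two_attractor R M d0 d1 -> d1 - d0 != 0.
Proof.
by move=> [_ _ H]; apply/eqP => E; apply: H; exists 0; rewrite E mulmx0.
Qed.

Lemma det_char_poly (d : nat) (M : 'M[int]_d) : `|\det M| = `|(char_poly M)`_0|.
Proof. by rewrite char_poly_det normrM normrX normrN1 expr1n mul1r. Qed.

Lemma norm_gt1_exp (R : realType) (z : R[i]) (n : nat) :
  (0 < n)%N -> 1 < `|z ^+ n| -> 1 < `|z|.
Proof. by move=> n0; rewrite normrX -[X in X < _](expr1n _ n) ltr_pXn2r // nnegrE. Qed.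

Lemma exists_pure_generator (R : realType) (d : nat) : (0 < d)%N ->
  exists (M : 'M[int]_d) (d0 d1 : 'cV[int]_d),
    generates_two_attractor R M d0 d1 /\ char_poly M = 'X^d - (2 * (-1) ^+ false)%:P.
Proof.
move=> d0; rewrite expr0 mulr1.
have [M pE] := exists_char_poly (monicXnsubC (2 : int) d0) (size_XnsubC 2 d0).
have dM : `|\det M| = 2.
  by rewrite det_char_poly pE coefB coefXn coefC (ltn_eqF d0) sub0r.
have eM : expanding R M.
  move=> z; rewrite eigenvalue_root_char -map_char_poly pE rmorphB /= map_polyXn map_polyC.
  rewrite /root !hornerE subr_eq0 => /eqP zd; apply: (norm_gt1_exp d0).
  by rewrite zd -intr_norm ltr1z.
have [a [b gM]] := exists_digits eM dM.
by exists M, a, b.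
Qed.

Lemma exists_mixed_generator (R : realType) (k : nat) : (0 < k)%N ->
  exists (M : 'M[int]_(k * 2)) (d0 d1 : 'cV[int]_(k * 2)),
    generates_two_attractor R M d0 d1 /\
    char_poly M = 'X^(k * 2) + (2 * (-1) ^+ true)%:P * 'X^k + 2%:P.
Proof.
move=> k0; pose p : {poly int} := 'X^(k * 2) + (2 * (-1) ^+ true)%:P * 'X^k + 2%:P.
have kk : (k < k * 2)%N by lia.
have k2 : (0 < k * 2)%N by lia.
pose q : {poly int} := (2 * (-1) ^+ true)%:P * 'X^k + 2%:P.
have pq : p = 'X^(k * 2) + q by rewrite /p addrA.
have sp1 : (size q < (k * 2).+1)%N.
  apply: leq_ltn_trans (size_polyD _ _) _; rewrite gtn_max; apply/andP; split.
    by rewrite mul_polyC size_scale // size_polyXn ltnS.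
  by rewrite size_polyC ltnS.
have sp : size p = (k * 2).+1.
  by rewrite pq size_polyDl size_polyXn.
have mp : p \is monic.
  by rewrite monicE pq lead_coefDl ?lead_coefXn // size_polyXn.
have [M pE] := exists_char_poly mp sp.
have dM : `|\det M| = 2.
  rewrite det_char_poly pE /p !coefD coefXn coefCM coefXn coefC.
  by rewrite (ltn_eqF k0) (ltn_eqF k2) mulr0 !add0r.
have eM : expanding R M.
  move=> z; rewrite eigenvalue_root_char -map_char_poly pE.
  rewrite rmorphD [in X in X + _]rmorphD rmorphM /= !map_polyXn !map_polyC /=.
  rewrite /root !hornerE exprM => /eqP zE; apply: (norm_gt1_exp k0).
  have {}zE : (z ^+ k) ^+ 2 + (2 * -1)%:~R * z ^+ k + (1 + 1) = 0 by rewrite addrA -[RHS]zE.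
  move: (z ^+ k) zE => y zE.
  (* Here [y] is [1 + i] or [1 - i], so its squared modulus is 2. *)
  apply: (norm_gt1_exp (isT : 0 < 2)%N); rewrite normrX.
  have yE : y ^+ 2 = 2 * y - 2 by rewrite -[LHS]subr0 -zE; ring.
  move: yE; case: (y) => yr yi yE.
  have twoE : (2 : R[i]) = (2 : R)%:C%C by rewrite rmorph_nat.
  have [reE imE] : yr ^+ 2 - yi ^+ 2 = 2 * yr - 2 /\ yr * yi = yi.
    move: yE; rewrite twoE expr2; simpc => -[h1 h2]; split; first by rewrite -h1; ring.
    lra.
  have nE : yr ^+ 2 + yi ^+ 2 = 2.
    have yi0 : yi != 0 by apply/eqP => yi0; move: reE; rewrite yi0; nra.
    have yr1 : yr = 1 by apply: (mulIf yi0); rewrite mul1r.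
    by move: reE; rewrite yr1; lra.
  have -> : `|(yr +i* yi)%C| ^+ 2 = 2.
    by rewrite sqr_normc twoE -nE; simpc; congr (_ +i* _)%C; ring.
  by rewrite ltr1n.
have [a [b gM]] := exists_digits eM dM.
by exists M, a, b.
Qed.

(** * Products of planar sets and the uniqueness of the dragon *)

Lemma planar_coordD (R : realType) (k : nat) (x y : 'cV[R]_(k * 2)) i :
  planar_coord (x + y) i = planar_coord x i + planar_coord y i.
Proof. by apply/colP => j; rewrite !mxE. Qed.

Lemma planar_coordZ (R : realType) (k : nat) (a : R) (x : 'cV[R]_(k * 2)) i :
  planar_coord (a *: x) i = a *: planar_coord x i.
Proof. by apply/colP => j; rewrite !mxE. Qed.

Lemma planar_coord0 (R : realType) (k : nat) i : planar_coord (0 : 'cV[R]_(k * 2)) i = 0.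
Proof. by apply/colP => j; rewrite !mxE. Qed.

(** The block diagonal matrix of the [L i], given by the images of the basis vectors to avoid
    arithmetic on indices below [k * 2]. *)
Definition planar_block (R : realType) (k : nat) (L : 'I_k -> 'M[R]_2) : 'M[R]_(k * 2) :=
  \matrix_(r, c) planar_col (fun i => L i *m planar_coord (delta_mx c 0) i) r 0.

Lemma mxvec_index_eq (m n : nat) (i i' : 'I_m) (j j' : 'I_n) :
  (mxvec_index i j == mxvec_index i' j') = (i == i') && (j == j').
Proof.
by rewrite /mxvec_index (inj_eq (@cast_ord_inj _ _ _)) (inj_eq enum_rank_inj) xpair_eqE.
Qed.

Lemma planar_blockE (R : realType) (k : nat) (L : 'I_k -> 'M[R]_2) x i :
  planar_coord (planar_block L *m x) i = L i *m planar_coord x i.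
Proof.
have LE j i' l : planar_block L (mxvec_index i j) (mxvec_index i' l) = (i == i')%:R * L i j l.
  rewrite mxE mxE mxvecE mxE mxE (bigD1 l) //= big1 => [|l' l'l].
    by rewrite !mxE mxvec_index_eq !eqxx !andbT addr0 mulrC.
  by rewrite !mxE mxvec_index_eq (negbTE l'l) andbF mulr0.
apply/colP => j; rewrite mxE mxE sum_mxvec_index (bigD1 i) //=.
rewrite [X in _ + X]big1 => [|i' i'i]; last first.
  by apply: big1 => l _; rewrite LE eq_sym (negbTE i'i) !mul0r.
rewrite addr0 [RHS]mxE; apply: eq_bigr => l _.
by rewrite LE eqxx mul1r [in RHS]mxE.
Qed.

Lemma planar_product_similar (R : realType) (k : nat) (K K' : 'I_k -> set 'cV[R]_2) :
  (forall i, affinely_similar (K i) (K' i)) ->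
  affinely_similar (planar_product K) (planar_product K').
Proof.
move=> KK'; have [Lc LcE] := choice (fun i => let: ex_intro L (ex_intro c H) := KK' i in
  ex_intro (fun Lc : 'M[R]_2 * 'cV[R]_2 => Lc.1 \in unitmx /\
    K' i = [set Lc.1 *m x + Lc.2 | x in K i]) (L, c) H).
pose L := planar_block (fun i => (Lc i).1); pose c := planar_col (fun i => (Lc i).2).
have LE x i : planar_coord (L *m x + c) i = (Lc i).1 *m planar_coord x i + (Lc i).2.
  by rewrite planar_coordD planar_blockE planar_colK.
exists L, c; split.
  apply: unitmx_inj => x Lx; apply: planar_coordP => i; rewrite planar_coord0.
  have [u _] := LcE i.
  have := planar_blockE (fun i => (Lc i).1) x i; rewrite -/L Lx planar_coord0 => /esym E.
  by rewrite -[LHS](mulKmx u) E mulmx0.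
apply/seteqP; split=> y.
  move=> yK; have yK' i : exists2 x, K i x & (Lc i).1 *m x + (Lc i).2 = planar_coord y i.
    by have [_ KE] := LcE i; have := yK i; rewrite -/(planar_coord y i) KE.
  have [x xE] := choice (fun i => let: ex_intro2 x h1 h2 := yK' i in
    ex_intro (fun x => K i x /\ (Lc i).1 *m x + (Lc i).2 = planar_coord y i) x (conj h1 h2)).
  exists (planar_col x) => [i|].
    by rewrite -/(planar_coord _ i) planar_colK; have [] := xE i.
  by apply: planar_coordP => i; rewrite LE planar_colK; have [] := xE i.
move=> [x xK <-] i; rewrite -/(planar_coord _ i) LE; have [_ ->] := LcE i.
by exists (planar_coord x i) => //; exact: xK.
Qed.

Lemma attractor_similar (R : realType) (d : nat) (M : 'M[int]_d) (d0 d1 : 'cV[int]_d) :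
  generates_two_attractor R M d0 d1 ->
  affinely_similar (subset_sums (orbit R M (d1 - d0))) (attractor R M [set d0; d1]).
Proof.
move=> [eM dM _]; have [c ->] := attractorE d0 d1 eM dM.
exact: affinely_similar_translate.
Qed.

(** Uniqueness of the dragon: both polynomials lead to the same model, because they differ only by
    signs of generators. *)
Lemma is_dragon_similar (R : realType) (K : set 'cV[R]_2) :
  is_dragon K -> affinely_similar (subset_sums (dragon_gen R)) K.
Proof.
move=> [M [d0 [d1 [gM pE]]]]; apply: affinely_similar_trans.
apply: affinely_similar_trans (attractor_similar gM).
have v0 := generator_neq0 gM; have [eM dM _] := gM.
have [b {}pE] : exists b : bool, char_poly M = 'X^2 + (2 * (-1) ^+ b)%:P * 'X + 2%:P.
  case: pE => ->; [exists true|exists false]; last by rewrite expr0 mulr1.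
  by rewrite expr1 mulrN1 polyCN mulNr.
exact: (mixed_dragon eM dM v0 pE).
Qed.

Lemma dragon_gen_is_dragon (R : realType) : is_dragon (subset_sums (dragon_gen R)).
Proof.
have [M [d0 [d1 [gM pE]]]] := exists_mixed_generator R (isT : 0 < 1)%N.
exists M, d0, d1; split=> //; first by left; rewrite pE expr1 mulrN1 polyCN mulNr.
apply: affinely_similar_sym; apply: affinely_similar_trans (attractor_similar gM).
have [eM dM _] := gM.
exact: (@mixed_dragon R M _ true eM dM (generator_neq0 gM) pE).
Qed.

(** A normal form: arbitrary dragons are replaced by copies of one model, and the cast by the
    identity. *)
Lemma is_dragon_productP (R : realType) (k : nat) (S : set 'cV[R]_(k * 2)) :
  is_dragon_product k S <->
  affinely_similar (planar_product (fun _ : 'I_k => subset_sums (dragon_gen R))) S.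
Proof.
have castE (A : set 'cV[R]_(k * 2)) (e : (k * 2 = k * 2)%N) :
    [set castmx (e, erefl) x | x in A] = A.
  by rewrite (eq_axiomK e); apply/seteqP; split=> [_ [x Ax <-]|x Ax]; last exists x;
    rewrite ?castmx_id.
split=> [[e [K [Kd]]]|SK].
  rewrite castE => KS; apply: affinely_similar_trans KS.
  by apply: planar_product_similar => i; exact/is_dragon_similar/Kd.
exists erefl, (fun=> subset_sums (dragon_gen R)); rewrite castE; split=> // _.
exact: dragon_gen_is_dragon.
Qed.

(** * Polytopes and their vertices *)

Lemma convex_hull_affine (R : realType) (d e : nat) (L : 'M[R]_(e, d)) c (A : set 'cV[R]_d) :
  convex_hull [set L *m x + c | x in A] = [set L *m x + c | x in convex_hull A].
Proof.
have fE x y (t : R) : L *m ((1 - t) *: x + t *: y) + c =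
    (1 - t) *: (L *m x + c) + t *: (L *m y + c).
  by rewrite !scalerDr mulmxDr -!scalemxAr addrACA -scalerDl subrK scale1r.
apply/seteqP; split.
  apply: convex_hull_sub => [_ _ t [x Ax <-] [y Ay <-] t01|_ [x Ax <-]].
    by exists ((1 - t) *: x + t *: y); [exact: convex_convex_hull|rewrite fE].
  by exists x => //; exact: sub_convex_hull.
move=> _ [x Ax <-].
suff : convex_hull A `<=` [set x | convex_hull [set L *m x + c | x in A] (L *m x + c)].
  by move=> /(_ x Ax).
apply: convex_hull_sub => [y z t /= hy hz t01|y Ay] /=.
  by rewrite fE; exact: convex_convex_hull.
by apply: sub_convex_hull; exists y.
Qed.

Lemma extreme_points_affine (R : realType) (d : nat) (L : 'M[R]_d) c (A : set 'cV[R]_d) :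
  L \in unitmx ->
  extreme_points [set L *m x + c | x in A] = [set L *m x + c | x in extreme_points A].
Proof.
move=> Lu; have finj x y : L *m x + c = L *m y + c -> x = y.
  by move=> /addIr /(congr1 (mulmx (invmx L))); rewrite !mulKmx.
have fE x y (t : R) : L *m ((1 - t) *: x + t *: y) + c =
    (1 - t) *: (L *m x + c) + t *: (L *m y + c).
  by rewrite !scalerDr mulmxDr -!scalemxAr addrACA -scalerDl subrK scale1r.
apply/seteqP; split=> [_ [[x Ax <-] ext]|_ [x [Ax ext] <-]].
  exists x => //; split=> // y z t Ay Az t01 xE.
  have [] := ext (L *m y + c) (L *m z + c) t; try by [exists y|exists z|].
    by rewrite xE fE.
  by move=> /finj -> /finj ->.
split; first by exists x.
move=> _ _ t [y Ay <-] [z Az <-] t01; rewrite -fE => /finj xE.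
by have [-> ->] := ext y z t Ay Az t01 xE.
Qed.

Definition polytope_with (R : realType) (d : nat) (n : nat) (P : set 'cV[R]_d) : Prop :=
  is_polytope P /\ (extreme_points P #= `I_n)%card.

Lemma image_mem_seq (T U : eqType) (f : T -> U) (s : seq T) :
  f @` [set` s] = [set` map f s].
Proof.
apply/seteqP; split=> [_ [x xs <-]|y /= /mapP[x xs ->]] /=; last by exists x.
exact: map_f.
Qed.

Lemma polytope_with_similar (R : realType) (d n : nat) (A B : set 'cV[R]_d) :
  affinely_similar A B -> polytope_with n (convex_hull A) -> polytope_with n (convex_hull B).
Proof.
move=> [L [c [Lu ->]]] [[s sE] cE]; rewrite /polytope_with convex_hull_affine; split.
  exists [seq L *m x + c | x <- s]; rewrite sE -convex_hull_affine.
  by rewrite (image_mem_seq (fun x => L *m x + c)).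
rewrite extreme_points_affine //; apply: card_eq_trans cE.
apply: inj_card_eq => x y _ _ /addIr /(congr1 (mulmx (invmx L))).
by rewrite !mulKmx.
Qed.

Lemma card_mem_seq (T : choiceType) (s : seq T) : uniq s -> ([set` s] #= `I_(size s))%card.
Proof.
case: s => [|x0 s'] us.
  by rewrite (_ : [set` _] = set0) ?II0 //; apply/seteqP; split.
move: (x0 :: s') us => s us.
rewrite (_ : [set` s] = nth x0 s @` `I_(size s)).
  apply: inj_card_eq => i j; rewrite !inE /= => si sj /eqP.
  by rewrite nth_uniq // => /eqP.
apply/seteqP; split=> [x /= xs|_ [i /= si <-]]; last exact: mem_nth.
by exists (index x s); rewrite /= ?index_mem ?nth_index.
Qed.

(** One factor at a time: with the other coordinates fixed, the points that may stand at place [i]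
    form a convex set containing [K i]. The induction on [n] keeps the first [n] coordinates in the
    hulls and the others in the sets. *)
Lemma convex_hull_planar_product (R : realType) (k : nat) (K : 'I_k -> set 'cV[R]_2) :
  convex_hull (planar_product K) = planar_product (fun i => convex_hull (K i)).
Proof.
apply/seteqP; split.
  apply: convex_hull_sub => [x y t xK yK t01 i|x xK i].
    rewrite -/(planar_coord _ i) planar_coordD !planar_coordZ.
    exact: convex_convex_hull.
  by apply: sub_convex_hull; exact: xK.
pose upd (x : 'cV[R]_(k * 2)) i y :=
  planar_col (fun i' => if i' == i then y else planar_coord x i').
have updE x i y i' : planar_coord (upd x i y) i' = if i' == i then y else planar_coord x i'.
  by rewrite planar_colK.
suff H n x : (n <= k)%N ->
    (forall i : 'I_k, if (i < n)%N then convex_hull (K i) (planar_coord x i)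
                       else K i (planar_coord x i)) ->
    convex_hull (planar_product K) x.
  by move=> x xK; apply: (H k) => // i; rewrite ltn_ord; exact: xK.
elim: n x => [|n IH] x nk xK.
  by apply: sub_convex_hull => i; have := xK i.
pose i := Ordinal nk.
have xi : convex_hull (K i) (planar_coord x i) by have := xK i; rewrite ltnSn.
suff sub : convex_hull (K i) `<=` [set y | convex_hull (planar_product K) (upd x i y)].
  have := sub _ xi; rewrite /= (_ : upd x i _ = x) //.
  by apply: planar_coordP => i'; rewrite updE; case: eqP => [->|].
apply: convex_hull_sub => [y z t /= hy hz t01|y Ky] /=.
  rewrite (_ : upd x i _ = (1 - t) *: upd x i y + t *: upd x i z).
    exact: convex_convex_hull.
  apply: planar_coordP => i'; rewrite planar_coordD !planar_coordZ !updE; case: eqP => // _.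
  by rewrite -scalerDl subrK scale1r.
apply: IH => [|i']; first exact: ltnW.
rewrite updE; case: eqP => [->|/eqP i'i]; first by rewrite ltnn.
have := xK i'; rewrite ltnS leq_eqVlt.
rewrite (_ : (i' == n :> nat) = false) //; apply/negbTE.
by apply: contra i'i => /eqP E; apply/eqP/val_inj.
Qed.

Lemma extreme_points_planar_product (R : realType) (k : nat) (K : 'I_k -> set 'cV[R]_2) :
  extreme_points (planar_product K) = planar_product (fun i => extreme_points (K i)).
Proof.
pose upd (x : 'cV[R]_(k * 2)) i y :=
  planar_col (fun i' => if i' == i then y else planar_coord x i').
have updE x i y i' : planar_coord (upd x i y) i' = if i' == i then y else planar_coord x i'.
  by rewrite planar_colK.
apply/seteqP; split=> x.
  move=> [xK ext] i; split; first exact: xK.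
  move=> y z t Ky Kz t01; rewrite -/(planar_coord x i) => xE.
  have updK y' : K i y' -> planar_product K (upd x i y').
    move=> Ky' i'; rewrite -/(planar_coord _ i') updE.
    by case: eqP => [->//|_]; exact: xK.
  have [|E1 E2] := ext (upd x i y) (upd x i z) t (updK _ Ky) (updK _ Kz) t01.
    apply: planar_coordP => i'; rewrite planar_coordD !planar_coordZ !updE.
    by case: eqP => [->//|_]; rewrite -scalerDl subrK scale1r.
  have := updE x i y i; have := updE x i z i.
  by rewrite E1 E2 eqxx.
move=> xK; split=> [i|y z t Ky Kz t01 xE]; first by case: (xK i).
suff H i : planar_coord y i = planar_coord x i /\ planar_coord z i = planar_coord x i.
  by split; apply: planar_coordP => i; case: (H i).
have [_ ext] := xK i; apply: (ext _ _ t) => //.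
by rewrite -/(planar_coord x i) xE planar_coordD !planar_coordZ.
Qed.

Lemma planar_product_seq (R : realType) (k : nat) (s : seq 'cV[R]_2) : uniq s ->
  exists s' : seq 'cV[R]_(k * 2), [/\ uniq s', size s' = (size s ^ k)%N &
    planar_product (fun _ : 'I_k => [set` s]) = [set` s']].
Proof.
move=> us; pose g (f : {ffun 'I_k -> 'I_(size s)}) := planar_col (fun i => nth 0 s (f i)).
exists (map g (enum {: {ffun 'I_k -> 'I_(size s)}})); split.
- rewrite map_inj_uniq ?enum_uniq // => f f' /(congr1 (@planar_coord R k)) E.
  apply/ffunP => i; apply: val_inj; apply/eqP.
  rewrite -(nth_uniq 0 (ltn_ord (f i)) (ltn_ord (f' i)) us).
  by have := congr1 (fun h => h i) E; rewrite !planar_colK => ->.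
- by rewrite size_map -cardE card_ffun !card_ord.
apply/seteqP; split=> x.
  move=> xs; have xi (i : 'I_k) : (index (planar_coord x i) s < size s)%N.
    by rewrite index_mem; exact: xs.
  apply/mapP; exists [ffun i => Ordinal (xi i)]; first by rewrite mem_enum.
  apply: planar_coordP => i; rewrite planar_colK ffunE /= nth_index //.
  exact: xs.
move=> /mapP[f _ ->] i; rewrite -/(planar_coord _ i) planar_colK /=.
exact: mem_nth.
Qed.

Lemma polytope_with_planar_product (R : realType) (k : nat) (K : set 'cV[R]_2) (n : nat) :
  polytope_with n (convex_hull K) ->
  polytope_with (n ^ k)%N (convex_hull (planar_product (fun _ : 'I_k => K))).
Proof.
move=> [[s sE] cE]; split.
  have [s' [_ _ s'E]] := planar_product_seq k (undup_uniq s).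
  exists s'; rewrite convex_hull_planar_product sE -s'E convex_hull_planar_product.
  have -> // : [set` undup s] = [set` s].
  by apply/seteqP; split=> x /=; rewrite mem_undup.
rewrite convex_hull_planar_product extreme_points_planar_product.
have finE : finite_set (extreme_points (convex_hull K)) by apply/finite_setP; exists n.
have [t tE ut] : exists2 t : seq 'cV[R]_2, extreme_points (convex_hull K) = [set` t] & uniq t.
  have /finite_seqP[t tE] := finE; exists (undup t); last exact: undup_uniq.
  by rewrite tE; apply/seteqP; split=> x /=; rewrite mem_undup.
have tn : size t = n.
  apply/card_eq_II; apply: card_eq_trans cE; rewrite tE.
  exact: card_esym (card_mem_seq ut).
have [s' [us' ss' s'E]] := planar_product_seq k ut.
rewrite tE s'E -tn -ss'; exact: card_mem_seq.
Qed.

Lemma summable_finite (R : realType) (d n : nat) (w : nat -> 'cV[R]_d) :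
  (forall j, (n <= j)%N -> w j = 0) -> summable w.
Proof.
move=> w0 i; pose a j : 'cV[R]_1 := const_mx `|w j i 0|.
have a0 j : (n <= j)%N -> a j = 0.
  by move=> nj; apply/matrixP => k l; rewrite !mxE w0 // mxE normr0.
have /has_sumP/(_ 0) H := has_sum_finite a0.
rewrite (_ : (fun j => _) = (fun j => a j 0 0)); last by apply/funext => j; rewrite mxE.
by apply/cvg_ex; eexists; exact: H.
Qed.

(** Here [f] vanishes on no nonzero generator, so its maximum is attained at a single point. *)
Lemma extreme_point_generic (R : realType) (d : nat) (w : nat -> 'cV[R]_d)
    (f : 'rV[R]_d) (e : nat -> bool) (s : 'cV[R]_d) :
  summable w ->
  (forall i, w i != 0 -> (f *m w i) 0 0 != 0 /\ e i = (0 < (f *m w i) 0 0)) ->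
  has_sum (fun i => (e i)%:R *: w i) s ->
  extreme_points (convex_hull (subset_sums w)) s.
Proof.
move=> sw fe hs; split.
  by apply: sub_convex_hull; exists e.
rewrite convex_hull_subset_sums // => y z t [a [a01 ha]] [b [b01 hb]] /andP[t0 t1] sE.
have w0 i : (f *m w i) 0 0 != 0 -> w i != 0.
  by apply: contra => /eqP ->; rewrite mulmx0 mxE.
have eE i : (f *m w i) 0 0 != 0 -> (e i)%:R = (0 < (f *m w i) 0 0)%R%:R :> R.
  by move=> /w0 /fe[_ ->].
have [ys aE] := max_coord a01 eE ha hs.
have [zs bE] := max_coord b01 eE hb hs.
have fsE : (f *m s) 0 0 = (1 - t) * (f *m y) 0 0 + t * (f *m z) 0 0.
  by rewrite {1}sE mulmx_lin.
have sub (c : nat -> R) v : (forall i, (f *m w i) 0 0 != 0 -> c i = (e i)%:R) ->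
    has_sum (fun i => c i *: w i) v -> v = s.
  move=> cE hv; apply: (has_sum_unique hv); move: hs; congr has_sum; apply/funext => i.
  have [->|wi] := eqVneq (w i) 0; first by rewrite !scaler0.
  by rewrite cE //; case: (fe i wi).
by split; [apply: sub ha; apply: aE|apply: sub hb; apply: bE]; nra.
Qed.

(** A coefficient strictly between 0 and 1 can be moved both ways, which makes [x] the midpoint of
    two other points of the zonoid. *)
Lemma extreme_coef (R : realType) (d : nat) (w : nat -> 'cV[R]_d) (t : nat -> R)
    (x : 'cV[R]_d) j :
  extreme_points (zonoid w) x -> (forall i, 0 <= t i <= 1) ->
  has_sum (fun i => t i *: w i) x -> w j != 0 -> t j = 0 \/ t j = 1.
Proof.
move=> [_ ext] t01 hx wj.
have /andP[t0 t1] := t01 j.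
have [->|tj0] := eqVneq (t j) 0; [by left|right].
apply/eqP; apply: contraT => tj1.
have tj0' : 0 < t j by rewrite lt_neqAle eq_sym tj0.
have tj1' : t j < 1 by rewrite lt_neqAle tj1.
pose del := Num.min (t j) (1 - t j).
have del0 : 0 < del by rewrite lt_min tj0' subr_gt0.
have [delt del1] : del <= t j /\ del <= 1 - t j by rewrite /del !ge_min !lexx orbT.
have pert (c : R) : `|c| <= del -> zonoid w (x + c *: w j).
  rewrite ler_norml => /andP[c1 c2].
  exists (fun i => t i + c * (i == j)%:R); split=> [i|].
    case: eqP => [->|_]; rewrite ?mulr1 ?mulr0 ?addr0 //.
    by apply/andP; split; lra.
  have := has_sumD hx (has_sumZ (a := c) (has_sum_delta (w := w) (j := j))).
  by congr has_sum; apply/funext => i; rewrite scalerA scalerDl.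
have [||||/eqP + _] := ext (x + del *: w j) (x + (- del) *: w j) 2^-1.
- by apply: pert; rewrite gtr0_norm.
- by apply: pert; rewrite normrN gtr0_norm.
- by apply/andP; split; lra.
- by apply/colP => i; rewrite !mxE; field.
by rewrite -subr_eq0 addrAC subrr add0r scaler_eq0 (negbTE wj) orbF gt_eqF.
Qed.

(** The cube is the zonoid of the standard basis continued by zeros, and its subset sums are the
    vectors with entries 0 and 1. *)
Lemma cube_polytope (R : realType) (d : nat) :
  polytope_with (2 ^ d)%N (convex_hull [set x : 'cV[R]_d | forall i, 0 <= x i 0 <= 1]).
Proof.
pose u j : 'cV[R]_d := \col_i ((i : nat) == j)%:R.
have u0 j : (d <= j)%N -> u j = 0.
  by move=> dj; apply/colP => i; rewrite !mxE ltn_eqF // (leq_trans (ltn_ord i)).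
have su (t : nat -> R) : has_sum (fun j => t j *: u j) (\col_i t i).
  rewrite (_ : \col_i t i = \sum_(j < d) t j *: u j).
    by apply: has_sum_finite => j dj; rewrite u0 ?scaler0.
  apply/colP => i; rewrite mxE summxE (bigD1 i) //= big1 ?addr0 => [|j ji]; rewrite !mxE.
    by rewrite eqxx mulr1.
  by rewrite (inj_eq val_inj) eq_sym (negbTE ji) mulr0.
have smu : summable u by exact: (summable_finite u0).
set C := [set x | _]; have CE : C = zonoid u.
  apply/seteqP; split=> x.
    move=> x01; pose t j := oapp (x^~ 0) 0 (insub j : option 'I_d).
    exists t; split=> [j|].
      by rewrite /t; case: insubP => [i _ _|_] /=; rewrite ?lexx ?ler01.
    by have := su t; congr has_sum; apply/colP => i; rewrite mxE /t valK.
  by move=> [t [t01 /(has_sum_unique (su t)) <-]] i; rewrite mxE.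
pose pt (f : {ffun 'I_d -> bool}) : 'cV[R]_d := \col_i (f i)%:R.
pose s := map pt (enum {: {ffun 'I_d -> bool}}).
have us : uniq s.
  rewrite map_inj_uniq ?enum_uniq // => f g /colP fg; apply/ffunP => i.
  by have := fg i; rewrite !mxE => /eqP; rewrite eqr_nat; case: (f i); case: (g i).
have ss : size s = (2 ^ d)%N by rewrite size_map -cardE card_ffun card_bool card_ord.
have sE : subset_sums u = [set` s].
  apply/seteqP; split=> x /=.
    move=> [e /(has_sum_unique (su _)) <-]; apply/mapP; exists [ffun i : 'I_d => e i].
      by rewrite mem_enum.
    by apply/colP => i; rewrite !mxE ffunE.
  move=> /mapP[f _ ->]; exists (fun j => oapp f false (insub j)).
  have := su (fun j => (oapp f false (insub j))%:R); congr has_sum.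
  by apply/colP => i; rewrite !mxE valK.
rewrite /polytope_with CE -convex_hull_subset_sums //.
have hull2 : convex_hull (convex_hull (subset_sums u)) = convex_hull (subset_sums u).
  apply/seteqP; split; last exact: sub_convex_hull.
  by apply: convex_hull_sub => //; exact: convex_convex_hull.
rewrite hull2; split; first by exists s; rewrite sE.
rewrite -ss; suff -> : extreme_points (convex_hull (subset_sums u)) = [set` s].
  exact: card_mem_seq.
apply/seteqP; split=> x.
  rewrite convex_hull_subset_sums // => ext; have [[t [t01 hx]] _] := ext.
  rewrite -sE; have xE := has_sum_unique (su t) hx.
  exists (fun j => t j == 1); have := su (fun j => (t j == 1)%:R); congr has_sum.
  rewrite -xE; apply/colP => i; rewrite !mxE.
  have ui : u i != 0.
    by apply/eqP => /colP /(_ i); rewrite !mxE eqxx => /eqP; rewrite oner_eq0.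
  have [->|->] := extreme_coef ext t01 hx ui; last by rewrite eqxx.
  by rewrite eq_sym oner_eq0.
move=> xs; have xG : subset_sums u x by rewrite sE.
split; first exact: sub_convex_hull.
rewrite convex_hull_subset_sums // -CE => y z r Cy Cz /andP[r0 r1] xE.
have /mapP[f _ xf] := xs.
suff H i : y i 0 = x i 0 /\ z i 0 = x i 0 by split; apply/colP => i; case: (H i).
have /andP[y0 y1] := Cy i; have /andP[z0 z1] := Cz i.
have := congr1 (fun v : 'cV_d => v i 0) xE; rewrite /= !mxE xf mxE.
by case: (f i) => /= E; split; nra.
Qed.

Lemma parallelepiped_polytope (R : realType) (d : nat) (G : set 'cV[R]_d) :
  is_parallelepiped G -> polytope_with (2 ^ d)%N (convex_hull G).
Proof. by move=> /polytope_with_similar; apply; exact: cube_polytope. Qed.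

(** * The hull of a dragon *)

(* Parallel generators [r l *: u i], [r] a probability distribution, add up to [u i]. *)
Lemma zonoid_merge (R : realType) (d k : nat) (w u : nat -> 'cV[R]_d) (r : nat -> R) :
  (0 < k)%N -> summable w -> (forall l i, (i < k)%N -> w (l * k + i)%N = r l *: u i) ->
  (forall l, 0 <= r l) -> series r @ \oo --> (1 : R) -> (forall j, (k <= j)%N -> u j = 0) ->
  zonoid w = zonoid u.
Proof.
move=> k0 sw wE r0 r1 u0.
have hu (t : nat -> R) : has_sum (fun j => t j *: u j) (\sum_(j < k) t j *: u j).
  by apply: has_sum_finite => j kj; rewrite u0 ?scaler0.
have r1' : (1 : R) = limn (series r) by rewrite (cvg_lim _ r1).
have cr : cvgn (series r) by apply/cvg_ex; exists 1.
apply/seteqP; split=> x [t [t01 hx]].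
  have cs i : cvgn (series (fun l => t (l * k + i)%N * r l)).
    apply: (series_le_cvg _ _ _ cr) => l //.
      by have /andP[? _] := t01 (l * k + i)%N; rewrite mulr_ge0.
    by have /andP[? ?] := t01 (l * k + i)%N; rewrite ler_piMl.
  (* The average of the coefficients in the class of [i], with weights [r]. *)
  pose s i := limn (series (fun l => t (l * k + i)%N * r l)).
  exists s; split=> [i|].
    apply/andP; split.
      apply: limr_ge => //; apply: nearW => n; apply: sumr_ge0 => l _.
      by have /andP[? _] := t01 (l * k + i)%N; rewrite mulr_ge0.
    rewrite r1'; apply: ler_lim => //; apply: nearW => n; apply: ler_sum => l _.
    by have /andP[? ?] := t01 (l * k + i)%N; rewrite ler_piMl.
  rewrite (has_sum_regroup (t := fun i : 'I_k => s i *: u i) k0 hx) => [|i]; first exact: hu.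
  have := has_sum_scalar (v := u i) (cs i); congr has_sum; apply/funext => l.
  by rewrite wE // scalerA.
rewrite (has_sum_unique hx (hu t)).
have [|s hs] := @summable_coef01 R d (fun j => t (j %% k)%N) w _ sw => [j|]; first exact: t01.
exists (fun j => t (j %% k)%N); split=> [j|]; first exact: t01.
rewrite -(has_sum_regroup (t := fun i : 'I_k => t i *: u i) k0 hs) // => i.
have := has_sum_scalar (v := t i *: u i) r1; rewrite scale1r; congr has_sum; apply/funext => l.
by rewrite modnMDl modn_small // wE // !scalerA mulrC.
Qed.

Definition vec2 (R : realType) (x y : R) : 'cV[R]_2 := \col_i (if i == 0 then x else y).

Lemma vec2D (R : realType) (x y x' y' : R) : vec2 x y + vec2 x' y' = vec2 (x + x') (y + y').
Proof. by apply/colP; apply: ord2_ind; rewrite !mxE. Qed.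

Lemma vec2B (R : realType) (x y x' y' : R) : vec2 x y - vec2 x' y' = vec2 (x - x') (y - y').
Proof. by apply/colP; apply: ord2_ind; rewrite !mxE. Qed.

Lemma vec2Z (R : realType) (a x y : R) : a *: vec2 x y = vec2 (a * x) (a * y).
Proof. by apply/colP; apply: ord2_ind; rewrite !mxE. Qed.

Lemma vec2_inj (R : realType) (x y x' y' : R) : vec2 x y = vec2 x' y' -> x = x' /\ y = y'.
Proof. by move=> /colP E; have := E 0; have := E 1; rewrite !mxE. Qed.

Lemma mul_row_vec2 (R : realType) (p q x y : R) :
  ((vec2 p q)^T *m vec2 x y) 0 0 = p * x + q * y.
Proof. by rewrite mxE big_ord_recl big_ord1 !mxE. Qed.

(** The first four values of [dragon_gen], in angular order; beyond them the default of [nth] gives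
    0. *)
Definition octagon_gen (R : realType) (j : nat) : 'cV[R]_2 :=
  vec2 (nth 0 [:: 1; 0; - 2^-1; - 2^-1] j) (nth 0 [:: 0; 1; 1; 2^-1] j).

Lemma octagon_gen_ge4 (R : realType) j : (4 <= j)%N -> octagon_gen R j = 0.
Proof.
by move=> j4; rewrite /octagon_gen !nth_default //; apply/colP; apply: ord2_ind; rewrite !mxE.
Qed.

Lemma dragon_gen_lt4 (R : realType) j : (j < 4)%N -> dragon_gen R j = octagon_gen R j.
Proof.
have e0 : dragon_gen R 0 = octagon_gen R 0.
  by apply/colP; apply: ord2_ind; rewrite !mxE.
have e1 : dragon_gen R 1 = octagon_gen R 1.
  have [h0 h1] := dragon_genS R 0; have [h2 h3] := dragon_gen0 R.
  by apply/colP; apply: ord2_ind; rewrite [RHS]mxE ?h0 ?h1 ?h2 h3 /=; lra.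
have e2 : dragon_gen R 2 = octagon_gen R 2.
  rewrite dragon_gen_rec e0 e1 /octagon_gen /= vec2Z vec2B.
  by congr vec2; field.
have e3 : dragon_gen R 3 = octagon_gen R 3.
  rewrite dragon_gen_rec e1 e2 /octagon_gen /= vec2Z vec2B.
  by congr vec2; field.
by case: j => [|[|[|[|]]]].
Qed.

Lemma octagon_sum (R : realType) (t : nat -> R) :
  has_sum (fun j => t j *: octagon_gen R j)
    (vec2 (t 0%N - t 2 / 2 - t 3 / 2) (t 1%N + t 2 + t 3 / 2)).
Proof.
have := @has_sum_finite R 2 4 (fun j => t j *: octagon_gen R j).
rewrite !big_ord_recl big_ord0 /octagon_gen /= !vec2Z addr0 !vec2D => H.
have := H _; rewrite (_ : vec2 _ _ = vec2 (t 0%N - t 2 / 2 - t 3 / 2) (t 1%N + t 2 + t 3 / 2)).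
  by apply=> j j4; rewrite -/(octagon_gen R j) octagon_gen_ge4 ?scaler0.
by congr vec2; rewrite /bump /=; field.
Qed.

(* Twice the coordinates of the vertices. *)
Definition octagon_vertices : seq (int * int) :=
  [:: (0, 0); (2, 0); (2, 2); (1, 4); (0, 5); (- 2, 5); (- 2, 3); (- 1, 1)].

Definition half_point (R : realType) (ab : int * int) : 'cV[R]_2 :=
  vec2 (ab.1%:~R / 2) (ab.2%:~R / 2).

Lemma octagon_extreme_sub (R : realType) (x : 'cV[R]_2) :
  extreme_points (zonoid (octagon_gen R)) x ->
  x \in map (half_point R) octagon_vertices.
Proof.
move=> ext; have [[t [t01 hx]] _] := ext.
have xE := has_sum_unique hx (octagon_sum (t := t)).
have u0 j : (j < 4)%N -> octagon_gen R j != 0.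
  move=> j4; apply/eqP => /colP E; have := E 0; have := E 1; rewrite !mxE.
  by case: j j4 {E} => [|[|[|[|]]]] //= _; lra.
have T j : (j < 4)%N -> t j = 0 \/ t j = 1.
  by move=> j4; exact: extreme_coef ext t01 hx (u0 j j4).
(* A 0-1 pattern with more than one change has another representation, by one
   of the relations [u0/2 - u1 + u2 = u0 - u1 + 2 u3 = u1/2 - u2 + u3 = 0]. *)
have bad (a b c e : R) : x = vec2 (a - c / 2 - e / 2) (b + c + e / 2) ->
    0 <= a <= 1 -> 0 < b < 1 -> 0 <= c <= 1 -> 0 <= e <= 1 -> False.
  move=> xE' a01 /andP[b0 b1] c01 e01.
  pose t' j := nth 0 [:: a; b; c; e] j.
  have t'01 j : 0 <= t' j <= 1.
    case: j => [|[|[|[|j]]]] //=; first by rewrite !ltW.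
    by rewrite /t' nth_default // lexx ler01.
  have := octagon_sum (t := t'); rewrite /t' /= -xE' => hx'.
  by have [] := extreme_coef ext t'01 hx' (u0 1%N isT); rewrite /t' /=; lra.
have mem (a b : int) : (a, b) \in octagon_vertices -> x = half_point R (a, b) ->
    x \in map (half_point R) octagon_vertices.
  by move=> ab ->; exact: map_f.
move: xE.
have [] := T 0%N isT => ->; have [] := T 1%N isT => ->;
  have [] := T 2 isT => ->; have [] := T 3 isT => -> xE.
- by apply: (mem 0 0) => //; rewrite xE /half_point /=; congr vec2; lra.
- by apply: (mem (-1) 1) => //; rewrite xE /half_point /=; congr vec2; lra.
- by case: (bad 0 4^-1 2^-1 2^-1); rewrite ?xE; [congr vec2|..]; lra.
- by apply: (mem (-2) 3) => //; rewrite xE /half_point /=; congr vec2; lra.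
- by case: (bad 4^-1 2^-1 2^-1 0); rewrite ?xE; [congr vec2|..]; lra.
- by case: (bad 4^-1 2^-1 2^-1 1); rewrite ?xE; [congr vec2|..]; lra.
- by case: (bad 4^-1 (3 / 4) 1 2^-1); rewrite ?xE; [congr vec2|..]; lra.
- by apply: (mem (-2) 5) => //; rewrite xE /half_point /=; congr vec2; lra.
- by apply: (mem 2 0) => //; rewrite xE /half_point /=; congr vec2; lra.
- by case: (bad (3 / 4) 4^-1 0 2^-1); rewrite ?xE; [congr vec2|..]; lra.
- by case: (bad (3 / 4) 2^-1 2^-1 0); rewrite ?xE; [congr vec2|..]; lra.
- by case: (bad (3 / 4) 2^-1 2^-1 1); rewrite ?xE; [congr vec2|..]; lra.
- by apply: (mem 2 2) => //; rewrite xE /half_point /=; congr vec2; lra.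
- by case: (bad 1 (3 / 4) 2^-1 2^-1); rewrite ?xE; [congr vec2|..]; lra.
- by apply: (mem 1 4) => //; rewrite xE /half_point /=; congr vec2; lra.
- by apply: (mem 0 5) => //; rewrite xE /half_point /=; congr vec2; lra.
Qed.

(** The lines orthogonal to the four generators cut the plane of functionals into eight sectors.
    Each pair [(p, q)] below is taken from one sector, and the vertex is the sum of the generators
    on which it is positive. *)
Lemma octagon_vertex_extreme (R : realType) (x : 'cV[R]_2) :
  x \in map (half_point R) octagon_vertices ->
  extreme_points (convex_hull (subset_sums (octagon_gen R))) x.
Proof.
have su := summable_finite (@octagon_gen_ge4 R).
have good (p q : R) (e : nat -> bool) (a b : int) :
    (forall j, (j < 4)%N -> let v := p * nth 0 [:: 1; 0; - 2^-1; - 2^-1] j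
       + q * nth 0 [:: 0; 1; 1; 2^-1] j in if e j then 0 < v else v < 0) ->
    half_point R (a, b) = vec2 ((e 0%N)%:R - (e 2)%:R / 2 - (e 3)%:R / 2)
                               ((e 1%N)%:R + (e 2)%:R + (e 3)%:R / 2) ->
    extreme_points (convex_hull (subset_sums (octagon_gen R))) (half_point R (a, b)).
  move=> eE ->.
  apply: (extreme_point_generic (f := (vec2 p q)^T) su) (octagon_sum (t := fun j => (e j)%:R)).
  move=> j uj; have j4 : (j < 4)%N.
    by rewrite ltnNge; apply: contra uj => /octagon_gen_ge4 ->.
  rewrite mul_row_vec2; have := eE j j4; move: (_ + _) => v /=.
  by case: (e j) => v0; [rewrite gt_eqF // v0|rewrite lt_eqF // ltNge ltW].
move=> /mapP[[a b] ab ->]; move: ab; rewrite !inE !xpair_eqE.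
do 7 ?[case/orP]; move=> /andP[/eqP-> /eqP->].
- apply: (good (-1) (-2) (nth false [:: false; false; false; false])).
    by case=> [|[|[|[|]]]] //= _; lra.
  by rewrite /half_point /=; congr vec2; lra.
- apply: (good 1 (-1) (nth false [:: true; false; false; false])).
    by case=> [|[|[|[|]]]] //= _; lra.
  by rewrite /half_point /=; congr vec2; lra.
- apply: (good 3 1 (nth false [:: true; true; false; false])).
    by case=> [|[|[|[|]]]] //= _; lra.
  by rewrite /half_point /=; congr vec2; lra.
- apply: (good 3 2 (nth false [:: true; true; true; false])).
    by case=> [|[|[|[|]]]] //= _; lra.
  by rewrite /half_point /=; congr vec2; lra.
- apply: (good 1 2 (nth false [:: true; true; true; true])).
    by case=> [|[|[|[|]]]] //= _; lra.
  by rewrite /half_point /=; congr vec2; lra.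
- apply: (good (-1) 1 (nth false [:: false; true; true; true])).
    by case=> [|[|[|[|]]]] //= _; lra.
  by rewrite /half_point /=; congr vec2; lra.
- apply: (good (-3) (-1) (nth false [:: false; false; true; true])).
    by case=> [|[|[|[|]]]] //= _; lra.
  by rewrite /half_point /=; congr vec2; lra.
- apply: (good (-3) (-2) (nth false [:: false; false; false; true])).
    by case=> [|[|[|[|]]]] //= _; lra.
  by rewrite /half_point /=; congr vec2; lra.
Qed.

Lemma octagon_polytope (R : realType) :
  polytope_with 8 (convex_hull (subset_sums (octagon_gen R))).
Proof.
have su := summable_finite (@octagon_gen_ge4 R).
split.
  pose P (f : {ffun 'I_4 -> bool}) : 'cV[R]_2 :=
    let t j := (oapp f false (insub j))%:R : R in
    vec2 (t 0%N - t 2 / 2 - t 3 / 2) (t 1%N + t 2 + t 3 / 2).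
  exists (map P (enum {: {ffun 'I_4 -> bool}})); congr convex_hull.
  apply/seteqP; split=> x /=.
    move=> [e /(has_sum_unique (octagon_sum (t := fun j => (e j)%:R))) <-].
    apply/mapP; exists [ffun i : 'I_4 => e i]; first by rewrite mem_enum.
    have E j : (j < 4)%N -> oapp [ffun i : 'I_4 => e i] false (insub j) = e j.
      by move=> j4; rewrite insubT /= ffunE.
    by rewrite /P !E.
  move=> /mapP[f _ ->]; exists (fun j => oapp f false (insub j)).
  exact: (octagon_sum (t := fun j => (oapp f false (insub j))%:R)).
rewrite (_ : extreme_points _ = [set` map (half_point R) octagon_vertices]).
  apply: card_mem_seq; rewrite map_inj_uniq // => -[a b] [a' b'].
  move=> /vec2_inj[/= /(mulIf _) E1 /(mulIf _) E2].
  have h0 : (2^-1 : R) != 0 by rewrite invr_eq0 pnatr_eq0.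
  by rewrite (intr_inj (E1 h0)) (intr_inj (E2 h0)).
apply/seteqP; split=> x /=; last exact: octagon_vertex_extreme.
by rewrite convex_hull_subset_sums //; exact: octagon_extreme_sub.
Qed.

(** Up to sign the generators are [4^-l] times the first four. The weights [(3 / 4) 4^-l] have sum
    1, so after rescaling by [3 / 4] and reversing every other block of four, the zonoid is that of
    the four octagon generators. *)
Lemma dragon_polytope (R : realType) : polytope_with 8 (convex_hull (subset_sums (dragon_gen R))).
Proof.
have sd := @dragon_gen_summable R.
pose w1 j := (3 / 4 : R)%:M *m dragon_gen R j.
have sw1 : summable w1 by exact: summable_mul.
pose w2 j := (-1) ^+ odd (j %/ 4) *: w1 j.
have sw2 : summable w2 by exact: (summable_sign (s := fun j => odd (j %/ 4))).
have sim : affinely_similar (subset_sums w2) (subset_sums (dragon_gen R)).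
  apply: affinely_similar_trans (subset_sums_flip (fun j => odd (j %/ 4)) sw1) _.
  apply: affinely_similar_sym; exists (3 / 4)%:M, 0; split.
    by rewrite unitmxE det_scalar unitfE expf_neq0 //; lra.
  rewrite /w1 subset_sums_mul //.
  by apply/seteqP; split=> _ [x Kx <-]; exists x; rewrite ?addr0.
apply: (polytope_with_similar sim).
rewrite convex_hull_subset_sums //.
have geo : series (geometric (3 / 4 : R) 4^-1) @ \oo --> (1 : R).
  have : `|4^-1 : R| < 1 by rewrite ger0_norm; lra.
  move=> /(cvg_geometric_series (a := 3 / 4)).
  by rewrite (_ : 3 / 4 * (1 - 4^-1)^-1 = 1 :> R) //; field.
rewrite (zonoid_merge (u := octagon_gen R) (k := 4) (r := geometric (3 / 4) 4^-1)) //.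
- rewrite -convex_hull_subset_sums; first exact: octagon_polytope.
  exact: (summable_finite (@octagon_gen_ge4 R)).
- move=> l i i4; rewrite /w2 /w1 /= divnMDl // divn_small // addn0 mul_scalar_mx.
  rewrite -dragon_gen_lt4 //.
  have -> : dragon_gen R (l * 4 + i) = (- 4^-1) ^+ l *: dragon_gen R i.
    elim: l => [|l IH]; first by rewrite mul0n add0n expr0 scale1r.
    by rewrite mulSn -addnA dragon_gen4 IH scalerA exprS.
  rewrite !scalerA signr_odd (exprNn 4^-1 l); congr (_ *: _).
  have ss : (-1) ^+ l * (-1) ^+ l = 1 :> R by rewrite -expr2 sqrr_sign.
  by rewrite mulrACA ss mul1r.
- by move=> l; rewrite /geometric /= mulr_ge0 ?exprn_ge0 //; lra.
- exact: octagon_gen_ge4.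
Qed.

(** * Hulls of attractors *)

(** A convex set stays convex when an extreme point is removed; if that point were outside [S], a
    smaller convex set would contain [S]. *)
Lemma extreme_points_hull_sub (R : realType) (d : nat) (S : set 'cV[R]_d) :
  extreme_points (convex_hull S) `<=` S.
Proof.
move=> x [Sx ext]; apply: contrapT => nSx.
suff : convex_hull S `<=` [set y | convex_hull S y /\ y <> x] by move=> /(_ x Sx) [].
apply: convex_hull_sub => [y z t [Sy yx] [Sz zx] /andP[t0 t1]|y Sy].
  split; first by apply: convex_convex_hull => //; rewrite t0.
  move: t0; rewrite le_eqVlt => /predU1P[<-|t0].
    by rewrite subr0 scale1r scale0r addr0.
  move: t1; rewrite le_eqVlt => /predU1P[->|t1].
    by rewrite subrr scale1r scale0r add0r.
  move=> xE; have [] := ext y z t Sy Sz _ (esym xE); first by rewrite t0.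
  by move=> /yx.
by split; [exact: sub_convex_hull|move=> yx; apply: nSx; rewrite -yx].
Qed.

Lemma polytope_finite_extreme (R : realType) (d : nat) (A : set 'cV[R]_d) :
  is_polytope (convex_hull A) -> finite_set (extreme_points (convex_hull A)).
Proof.
move=> [s ->]; apply: sub_finite_set (finite_seq s).
exact: extreme_points_hull_sub.
Qed.

Lemma euclidean_norm_le (R : realType) (d : nat) (x : 'cV[R]_d) :
  euclidean_norm x <= \sum_i `|x i 0|.
Proof.
have S0 : 0 <= \sum_i `|x i 0| by apply: sumr_ge0.
rewrite /euclidean_norm -[leRHS]ger0_norm // -sqrtr_sqr ler_wsqrtr //.
rewrite expr2 mulr_suml; apply: ler_sum => i _.
rewrite -(real_normK (num_real _)) expr2 ler_wpM2l //.
by rewrite (bigD1 i) //= lerDl sumr_ge0.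
Qed.

Lemma orbit_neq0 (R : realType) (d : nat) (M : 'M[int]_d) (v : 'cV[int]_d) j :
  `|\det M| = 2 -> v != 0 -> orbit R M v j != 0.
Proof.
move=> dM; apply: contra => /eqP wj0.
by have := orbit_shift0 R v j dM; rewrite wj0 mulmx0 => /esym /map_intr_eq0 ->.
Qed.

(** The segments run from 0 to [w n], except that the first one is shifted by [c] to account for the
    translation. *)
Lemma attractor_zonotope (R : realType) (d : nat) (M : 'M[int]_d) (d0 d1 : 'cV[int]_d) :
  generates_two_attractor R M d0 d1 ->
  is_infinite_zonotope (convex_hull (attractor R M [set d0; d1])).
Proof.
move=> gM; have [eM dM _] := gM; have v0 := generator_neq0 gM.
have [c ->] := attractorE d0 d1 eM dM.
set w := orbit R M (d1 - d0); have sw : summable w by exact: orbit_summable.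
have hullE : convex_hull [set x + c | x in subset_sums w] = [set x + c | x in zonoid w].
  have := convex_hull_affine 1%:M c (subset_sums w).
  rewrite convex_hull_subset_sums //.
  by under eq_imagel => x _ do rewrite mul1mx; under [RHS]eq_imagel => x _ do rewrite mul1mx.
pose a (n : nat) : 'cV[R]_d := (n == 0%N)%:R *: c.
have ha : has_sum a c := @has_sum_delta R d (fun=> c) 0%N.
exists a, (fun n => a n + w n); split.
- move=> n; rewrite -subr_eq0 opprD addrA subrr add0r oppr_eq0.
  exact: orbit_neq0.
- under eq_fun => n do rewrite addrC addKr.
  have cs : cvgn (series (fun n => \sum_i `|w n i 0|)).
    rewrite (_ : series _ = fun n => \sum_i series (fun j => `|w j i 0|) n).
      apply/cvg_ex; exists (\sum_i limn (series (fun j => `|w j i 0|))).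
      by apply: cvg_sumr => i; exact: sw.
    by apply/funext => n; rewrite /series /= exchange_big.
  apply: series_le_cvg cs => n; [exact: sqrtr_ge0|by apply: sumr_ge0|exact: euclidean_norm_le].
rewrite hullE; apply/seteqP; split=> x.
  move=> [y [t [t01 hy]] <-]; exists (fun n => a n + t n *: w n); split.
    move=> n; exists (t n); first by rewrite /= in_itv /=; exact: t01.
    by rewrite scalerDr addrA -scalerDl subrK scale1r.
  by have := has_sumD ha hy; rewrite addrC.
move=> [s [sE hs]].
have tE n : exists t : R, 0 <= t <= 1 /\ s n = a n + t *: w n.
  have [t /=] := sE n; rewrite in_itv /= => t01 <-; exists t; split=> //.
  by rewrite scalerDr addrA -scalerDl subrK scale1r.
have [t tP] := choice tE.
exists (x - c); last by rewrite subrK.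
exists t; split=> [n|]; first by case: (tP n).
have := has_sumB (hs : has_sum s x) ha; congr has_sum; apply/funext => n.
by have [_ ->] := tP n; rewrite addrC addKr.
Qed.

Lemma attractor_trichotomy (R : realType) (d : nat) (M : 'M[int]_d) (d0 d1 : 'cV[int]_d) :
  (0 < d)%N -> generates_two_attractor R M d0 d1 ->
  let G := attractor R M [set d0; d1] in
  [\/ is_parallelepiped G, exists2 k, d = (k * 2)%N & is_dragon_product k G |
      infinite_set (extreme_points (convex_hull G))].
Proof.
move=> dgt0 gM G; have [eM dM _] := gM; have v0 := generator_neq0 gM.
have sim := attractor_similar gM.
have sw : summable (orbit R M (d1 - d0)) by exact: orbit_summable.
have [[n [n0 [mu Mn]]]|nM] := pselect (exists n, (0 < n)%N /\
    exists mu : R, (map_mx intr M : 'M[R]_d) ^+ n = mu%:M); last first.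
  constructor 3.
  have inf : infinite_set (extreme_points (convex_hull (subset_sums (orbit R M (d1 - d0))))).
    apply: infinite_extreme_points => // i j mu ij.
    by apply/eqP => wE; apply: nM; exact: (orbit_parallel eM dM v0 ij wE).
  have [L [c [Lu GE]]] := affinely_similar_sym sim; rewrite -/G in GE.
  apply: contra_not inf; rewrite GE convex_hull_affine extreme_points_affine //.
  exact: finite_image.
have [[s sb pE]|[k [s [sb dk pE]]]] := charpoly_classification dgt0 n0 dM Mn.
  constructor 1; rewrite /is_parallelepiped; apply: affinely_similar_trans sim.
  have [b sE] : exists b : bool, s = (-1) ^+ b.
    by move: sb; rewrite !inE => /orP[]/eqP->; [exists true|exists false].
  by apply: (@pure_parallelepiped R d M _ b) => //; rewrite pE sE.
constructor 2; exists k => //; subst d.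
apply/is_dragon_productP; apply: affinely_similar_trans sim.
have [b sE] : exists b : bool, s = (-1) ^+ b.
  by move: sb; rewrite !inE => /orP[]/eqP->; [exists true|exists false].
apply: (@mixed_dragon_product R k M _ b) => //; last by rewrite pE sE.
by move: dgt0; case: (k).
Qed.

Theorem theorem6 (R : realType) (d : nat) (d_gt0 : (0 < d)%N) :
  (* both types occur *)
  (exists G : set 'cV[R]_d, is_two_attractor G /\ is_parallelepiped G) /\
  (~~ odd d ->
     exists G : set 'cV[R]_d, is_two_attractor G /\ is_dragon_product d./2 G) /\
  (* each type is a single class up to affine similarity, and they differ *)
  (forall G G' : set 'cV[R]_d, is_two_attractor G -> is_two_attractor G' ->
     is_parallelepiped G -> is_parallelepiped G' -> affinely_similar G G') /\
  (forall G G' : set 'cV[R]_d, is_two_attractor G -> is_two_attractor G' ->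
     is_dragon_product d./2 G -> is_dragon_product d./2 G' ->
     affinely_similar G G') /\
  (forall G : set 'cV[R]_d, is_two_attractor G ->
     ~ (is_parallelepiped G /\ is_dragon_product d./2 G)) /\
  (* their convex hulls are polytopes with 2^d, resp. 2^(3d/2), vertices *)
  (forall G : set 'cV[R]_d, is_two_attractor G -> is_parallelepiped G ->
     is_polytope (convex_hull G) /\
     (extreme_points (convex_hull G) #= `I_(2 ^ d))%card) /\
  (forall G : set 'cV[R]_d, is_two_attractor G -> is_dragon_product d./2 G ->
     is_polytope (convex_hull G) /\
     (extreme_points (convex_hull G) #= `I_(2 ^ (3 * d)./2))%card) /\
  (* no other 2-attractor has a polytope as its convex hull *)
  (forall G : set 'cV[R]_d, is_two_attractor G -> is_polytope (convex_hull G) ->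
     is_parallelepiped G \/ ~~ odd d /\ is_dragon_product d./2 G) /\
  (* all the other 2-attractors *)
  (forall G : set 'cV[R]_d, is_two_attractor G ->
     ~ is_parallelepiped G -> ~ (~~ odd d /\ is_dragon_product d./2 G) ->
     is_infinite_zonotope (convex_hull G) /\
     infinite_set (extreme_points (convex_hull G))).

Proof.
have vertices (G : set 'cV[R]_d) : is_dragon_product d./2 G -> ~~ odd d /\
    polytope_with (2 ^ (3 * d)./2)%N (convex_hull G).
  move=> [e [K [Kd KG]]]; have GD : is_dragon_product d./2 G by exists e, K.
  split; first by rewrite -e muln2 odd_double.
  move: (d./2) e GD {K Kd KG} => k e; subst d => /is_dragon_productP sim.
  rewrite (_ : (3 * (k * 2))./2 = 3 * k)%N; last by rewrite mulnA muln2 doubleK.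
  rewrite expnM; apply: polytope_with_similar sim _.
  exact/polytope_with_planar_product/dragon_polytope.
have uniq_dragon (G G' : set 'cV[R]_d) : is_dragon_product d./2 G -> is_dragon_product d./2 G' ->
    affinely_similar G G'.
  move=> [e [K [Kd KG]]]; have GD : is_dragon_product d./2 G by exists e, K.
  move=> [e' [K' [Kd' KG']]]; have GD' : is_dragon_product d./2 G' by exists e', K'.
  move: (d./2) e GD GD' {K Kd KG e' K' Kd' KG'} => k e; subst d.
  move=> /is_dragon_productP sim /is_dragon_productP.
  exact/affinely_similar_trans/affinely_similar_sym.
have cases (G : set 'cV[R]_d) : is_two_attractor G -> [\/ is_parallelepiped G,
    ~~ odd d /\ is_dragon_product d./2 G | infinite_set (extreme_points (convex_hull G))].
  move=> [M [d0 [d1 [gM ->]]]].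
  case: (attractor_trichotomy d_gt0 gM) => [P|[k dk D]|I];
    [constructor 1|constructor 2|constructor 3] => //.
  have hk : d./2 = k by rewrite dk muln2 doubleK.
  by rewrite hk; split=> //; rewrite dk muln2 odd_double.
split.
  have [M [d0 [d1 [gM pE]]]] := exists_pure_generator R d_gt0.
  exists (attractor R M [set d0; d1]); split; first by exists M, d0, d1.
  rewrite /is_parallelepiped; apply: affinely_similar_trans (attractor_similar gM).
  have [eM dM _] := gM.
  exact: (pure_parallelepiped d_gt0 eM dM (generator_neq0 gM) pE).
split.
  move=> d_even; have dk : d = (d./2 * 2)%N by rewrite muln2 even_halfK.
  move: (d./2) dk => k dk; subst d.
  have k0 : (0 < k)%N by move: d_gt0; case: (k).
  have [M [d0 [d1 [gM pE]]]] := exists_mixed_generator R k0.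
  exists (attractor R M [set d0; d1]); split; first by exists M, d0, d1.
  apply/is_dragon_productP; apply: affinely_similar_trans (attractor_similar gM).
  have [eM dM _] := gM.
  exact: (mixed_dragon_product k0 eM dM (generator_neq0 gM) pE).
split.
  move=> G G' _ _ cG cG'; exact: affinely_similar_trans (affinely_similar_sym cG) cG'.
split; first by move=> G G' _ _; exact: uniq_dragon.
split.
  (* The numbers of vertices differ, since [3 d / 2] is not [d] for [d > 0]. *)
  move=> G _ [/parallelepiped_polytope[_ c1] /vertices[dk [_ c2]]].
  have /card_eq_II/eqP := card_eq_trans (card_esym c1) c2.
  rewrite eqn_exp2l // => /eqP; move: d_gt0 (even_halfK dk); rewrite -!divn2; lia.
split; first by move=> G _; exact: parallelepiped_polytope.
split; first by move=> G _ /vertices[].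
split.
  move=> G GA pG; case: (cases G GA) => [|D|]; [by left|by right|].
  by move=> I; case: I; exact: polytope_finite_extreme.
move=> G GA nP nD; split; last by case: (cases G GA).
by have [M [d0 [d1 [gM ->]]]] := GA; exact: attractor_zonotope.
Qed.
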